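(* Let $0\le\alpha<1$, $\theta>-\alpha$, let $P$ be the law PDP$(\alpha,\theta)$, and let $\kappa\in\mathbb N$. For $n\in\mathbb N$ and $\pi^n\in\mathfrak m_n$ define $$\mathcal L^{\mathcal H}(\pi^n)=(\theta+n)\left(E_{\mathbf P(\cdot\mid\mathbf 1^n)}(\mathcal H)-E_{\mathbf P(\cdot\mid\pi^n)}(\mathcal H)\right),$$ $$\mathcal L^{\mathfrak G^{(\kappa)}}(\pi^n)=\Big(\prod_{r=0}^{\kappa}(\theta+n+r)\Big)\left(E_{\mathbf P(\cdot\mid\mathbf 1^n)}(\mathfrak G^{(\kappa)})-E_{\mathbf P(\cdot\mid\pi^n)}(\mathfrak G^{(\kappa)})\right).$$ Then for every $n\ge2$, every $\pi^{n-1}\in\mathfrak m_{n-1}$ and every $\pi^n\in\mathcal C(\pi^{n-1})$, the quantities $$\mathcal L^{\mathcal H}(\pi^n)-\mathcal L^{\mathcal H}(\pi^{n-1})\quad\text{and}\quad \mathcal L^{\mathfrak G^{(\kappa)}}(\pi^n)-\mathcal L^{\mathfrak G^{(\kappa)}}(\pi^{n-1})$$ are nonnegative, and each of them vanishes exactly when $\pi^n=(\pi^{n-1},1)$, i.e. when a new class appears at $n$.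
   Context: $\mathbb N=\{1,2,\dots\}$. $\mathcal S^{\downarrow}=\{s=(s(i):i\in\mathbb N): s(i)\ge s(i+1)\ge 0\ \forall i,\ \sum_i s(i)=1\}$. The Shannon entropy is $\mathcal H(s)=-\sum_{i}s(i)\log s(i)$ ($0\log0=0$) and the generalized Gini function is $\mathfrak G^{(\kappa)}(s)=1-\sum_i s(i)^{\kappa+1}$. PDP$(\alpha,\theta)$ is the probability law $P$ on $\mathcal S^{\downarrow}$ of the decreasing rearrangement of $(\hat\pi(j):j\in\mathbb N)$, where $\hat\pi(1)=W_1$, $\hat\pi(j)=W_j\prod_{i=1}^{j-1}(1-W_i)$ for $j\ge2$, and the $W_j$ are independent with $W_j\sim\mathrm{Beta}(1-\alpha,\theta+\alpha j)$. Let $S\sim P$, and let $(X_l:l\ge1)$ be i.i.d. uniform on $[0,1]$, independent of $S$. To $s\in\mathcal S^{\downarrow}$ one associates disjoint open subintervals of $[0,1]$ whose lengths ranked decreasingly are $s$. Two individuals $X_l,X_m$ are of the same species (class) if they fall in the same interval associated with $S$; species are numbered $1,2,\dots$ in order of first appearance. $k^n$ is the number of species among $X_1,\dots,X_n$, $\pi^n(j)$ is the number of the first $n$ individuals in the $j$-th discovered species, and $\pi^n=(\pi^n(1),\dots,\pi^n(k^n))$. $\mathfrak m_n$ is the set of all possible values of $\pi^n$, i.e. all finite vectors of positive integers with sum $n$; $\mathbf 1^n=(1,\dots,1)\in\mathfrak m_n$ is the vector of length $n$ of ones. For $\pi^{n-1}\in\mathfrak m_{n-1}$, $\mathcal C(\pi^{n-1})\subset\mathfrak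 m_n$ is the set of possible successors: the vectors obtained from $\pi^{n-1}$ by adding $1$ to one coordinate, together with $(\pi^{n-1},1)$ (a new class). $\mathbf P$ is the joint law of $S$ and $(\pi^n:n\in\mathbb N)$. For a value $\pi^n\in\mathfrak m_n$ (each has positive probability), $E_{\mathbf P(\cdot\mid\pi^n)}(G)$ is the Bayes posterior mean: the conditional expectation of $G(S)$ given that the abundance vector at step $n$ equals $\pi^n$. *)

(* Defs.v *)
From HB Require Import structures.
From mathcomp Require Import all_boot all_order all_algebra.
From mathcomp Require Import all_classical all_reals all_analysis.

Set Implicit Arguments.
Unset Strict Implicit.
Unset Printing Implicit Defensive.

Import Order.TTheory GRing.Theory Num.Theory.
Import numFieldNormedType.Exports.

Local Open Scope classical_set_scope.
Local Open Scope ring_scope.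

(* Indices are shifted throughout: s(i), W_j, X_l (i, j, l >= 1) are            *)
(* [s i.-1], [W j.-1], [X l.-1] here.                                           *)

(* Real sequences with the product sigma-algebra. *)
Definition cylinders (R : realType) : set (set (nat -> R)) :=
  \bigcup_(i in [set: nat])
    preimage_set_system setT (fun s : nat -> R => s i) measurable.

Arguments cylinders : clear implicits.

Notation seqspace R := (g_sigma_algebraType (cylinders R)).

Definition Sdown (R : realType) : set (nat -> R) :=
  [set s | (forall i, 0 <= s i.+1 <= s i) /\
           (\sum_(0 <= i <oo) (s i)%:E = 1)%E].

(* [ln 0 = 0] in the library, which gives the convention 0 log 0 = 0.           *)
(* The entropy of a point of S^down may be infinite.                            *)
Definition entropy (R : realType) (s : nat -> R) : \bar R :=
  (\sum_(0 <= i <oo) (- (s i * ln (s i)))%:E)%E.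

Definition gini (R : realType) (kappa : nat) (s : nat -> R) : \bar R :=
  (1 - \sum_(0 <= i <oo) (s i ^+ kappa.+1)%:E)%E.

Definition mutually_independent d (T : measurableType d) (R : realType)
    (Pr : probability T R) d' (T' : measurableType d')
    (X : nat -> {RV Pr >-> T'}) :=
  forall (J : seq nat) (A : nat -> set T'), uniq J ->
    (forall j, measurable (A j)) ->
    (Pr (\bigcap_(j in [set` J]) (X j @^-1` A j)) =
     \prod_(j <- J) Pr (X j @^-1` A j))%E.

(* The beta distribution of the library only has integer parameters. *)
Definition real_beta_weight (R : realType) (a b x : R) : R :=
  x `^ (a - 1) * (1 - x) `^ (b - 1).

Definition real_beta_fun (R : realType) (a b : R) : R :=
  (\int[lebesgue_measure]_(x in `]0, 1[) real_beta_weight a b x)%R.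

Definition beta_distributed d (T : measurableType d) (R : realType)
    (Pr : probability T R) (X : {RV Pr >-> R}) (a b : R) :=
  forall A : set R, measurable A ->
    distribution Pr X A =
    (\int[lebesgue_measure]_(x in A `&` `]0%R, 1%R[)
       (real_beta_weight a b x / real_beta_fun a b)%:E)%E.

Definition stick_breaking (R : realType) (W : nat -> R) (j : nat) : R :=
  W j * \prod_(i < j) (1 - W i).

(* A bijective reindexing suffices here: the stick-breaking weights used below  *)
(* are almost surely all positive, so no zero has to be discarded.              *)
Definition decreasing_rearrangement (R : realType) (t s : nat -> R) :=
  (forall i, s i.+1 <= s i) /\
  exists2 sigma : nat -> nat, bijective sigma & forall i, s i = t (sigma i).

(* P is PDP(alpha, theta): the law of the decreasing rearrangement of the       *)
(* stick-breaking sequence, on some probability space carrying the W_j.         *)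
Definition is_PDP (R : realType) (alpha theta : R)
    (P : probability (seqspace R) R) :=
  exists (d : measure_display) (T : measurableType d) (Q : probability T R)
         (W : nat -> {RV Q >-> R}) (V : {RV Q >-> seqspace R}),
    [/\ mutually_independent W,
        forall j, beta_distributed (W j) (1 - alpha) (theta + alpha * j.+1%:R),
        {ae Q, forall w,
           decreasing_rearrangement (stick_breaking (fun j => W j w)) (V w)} &
        forall A, measurable A -> P A = distribution Q V A].

(* The open intervals associated with s are ]left s i, left s i + s i[; any     *)
(* measurable choice of their positions is allowed.  Terms s i = 0 contribute   *)
(* empty intervals.                                                             *)
Definition interval_system (R : realType)
    (left : nat -> seqspace R -> R) :=
  (forall i, measurable_fun (@Sdown R : set (seqspace R)) (left i)) /\
  forall s, Sdown s ->
    (forall i, `]left i s, left i s + s i[ `<=` `[0, 1]) /\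
    trivIset setT (fun i => [set` `]left i s, left i s + s i[]).

(* The first disjunct makes a point lying in no interval (a null event) the     *)
(* only member of its species.                                                  *)
Definition same_species (R : realType) (left : nat -> seqspace R -> R)
    (s x : nat -> R) (l m : nat) : bool :=
  `[< l = m \/ exists i, (x l \in `]left i s, left i s + s i[) /\
                         (x m \in `]left i s, left i s + s i[) >].

(* One entry for each l < n that belongs to no species discovered before l,     *)
(* hence species are listed in order of first appearance.                       *)
Definition abundance (same : rel nat) (n : nat) : seq nat :=
  [seq count (same l) (iota 0 n) |
     l <- iota 0 n & ~~ has (same l) (iota 0 l)].

Definition abundance_vectors (n : nat) : set (seq nat) :=
  [set p | all (leq 1) p && (sumn p == n)].

Definition successors (p : seq nat) : set (seq nat) :=
  [set q | q = rcons p 1%N \/ exists2 i, (i < size p)%N & q = incr_nth p i].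

Definition cond_mean d (T : measurableType d) (R : realType)
    (Pr : probability T R) (A : set T) (Y : T -> \bar R) : \bar R :=
  ((\int[Pr]_(w in A) Y w) / Pr A)%E.

Section posterior.
Context d (T : measurableType d) (R : realType) (Pr : probability T R).
Variables (S : {RV Pr >-> seqspace R}) (X : nat -> {RV Pr >-> R}).
Variables (left : nat -> seqspace R -> R).

Definition iid_uniform :=
  mutually_independent X /\
  forall l (A : set R), measurable A ->
    distribution Pr (X l) A = uniform_prob (@ltr01 R) A.

Definition independent_of_sample :=
  forall A B : set (seqspace R), measurable A -> measurable B ->
    (Pr (S @^-1` A `&` (fun w l => X l w) @^-1` B) =
     Pr (S @^-1` A) * Pr ((fun w l => X l w) @^-1` B))%E.

Definition abundance_event (n : nat) (p : seq nat) : set T :=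
  [set w | abundance (same_species left (S w) (fun l => X l w)) n = p].

Definition posterior_mean (G : (nat -> R) -> \bar R) (n : nat) (p : seq nat) :=
  cond_mean Pr (abundance_event n p) (fun w => G (S w)).

Definition L_entropy (theta : R) (n : nat) (p : seq nat) : \bar R :=
  ((theta + n%:R)%:E *
   (posterior_mean (@entropy R) n (nseq n 1%N) -
    posterior_mean (@entropy R) n p))%E.

Definition L_gini (theta : R) (kappa n : nat) (p : seq nat) : \bar R :=
  ((\prod_(0 <= r < kappa.+1) (theta + n%:R + r%:R))%:E *
   (posterior_mean (gini kappa) n (nseq n 1%N) -
    posterior_mean (gini kappa) n p))%E.

End posterior.

(* Main.v *)
From HB Require Import structures.
Require Import Defs.
From mathcomp Require Import all_boot all_order all_algebra.
From mathcomp Require Import all_classical all_reals all_analysis.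
From mathcomp Require Import measurable_realfun.
From mathcomp Require Import ring lra zify.
Import Order.TTheory GRing.Theory Num.Theory.
Import numFieldNormedType.Exports.
Local Open Scope classical_set_scope.
Local Open Scope ring_scope.
Set Implicit Arguments.
Unset Strict Implicit.
Unset Printing Implicit Defensive.

(** Write s_i for the frequencies and p = (p_1, ..., p_k) for an abundance vector
    of n individuals.  Given the frequencies, a sample has the abundances p with
    probability c * D(s, p), where D(s, p) is the sum of the products
    s_(i_1) ^ p_1 * ... * s_(i_k) ^ p_k over distinct indices and c counts the
    patterns with these abundances ([sampling_identity],
    [integral_abundance_event]).  The constant c cancels in the posterior means,
    which are therefore quotients of expectations of D ([posterior_meanE]).

    The expectation of D(S, p) is Pitman's partition probability function
    ([expected_dsum]).  As a polynomial in the power sums of s, D does not see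
    the ranking, so it may be computed on the stick-breaking sequence.  Splitting
    off the first stick turns it into a recursion whose coefficients are beta
    moments ([eppf_recursion], [beta_moment_val]).  The recursion bounds the
    expectation for finitely many sticks, hence for all of them, by Pitman's
    formula.  Since the frequencies add up to one, both the expectation and the
    formula satisfy the same consistency relation between p and its successors,
    and this forces equality.

    The product of D(s, p) with a power sum is again a sum of terms D(s, q): the
    new index is either distinct from the others or equal to one of them.  This
    gives the posterior mean of every power sum, hence of the Gini functions.
    The entropy is expanded by - x ln x = sum_m x (1 - x) ^ m / m into
    combinations of power sums, which the Chu-Vandermonde identity evaluates;
    the resulting series differ by harmonic sums ([log_moment_shift]), and the
    remaining transcendental term depends on n only ([posterior_entropy]).

    Consequently both quantities have the form
        L(p) = g(p_1) + ... + g(p_k) - n * g(1),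
    with g(a) = (a - alpha) * sum_(i < a) 1 / (1 - alpha + i) for the entropy, and
    with rising factorials for the Gini functions.  A new class adds
    g(1) - g(1) = 0; an individual added to a class with a members adds
    g(a + 1) - g(a) - g(1), which is positive. *)

(** * Sums over distinct indices *)

Fixpoint bumps (m : nat) (p : seq nat) : seq (seq nat) :=
  if p is a :: p' then ((m + a)%N :: p') :: [seq a :: q | q <- bumps m p']
  else [::].

Fixpoint deletions (p : seq nat) : seq (nat * seq nat) :=
  if p is a :: p' then (a, p') :: [seq (x.1, a :: x.2) | x <- deletions p']
  else [::].

Lemma size_bumps m p q : q \in bumps m p -> size q = size p.
Proof.
elim: p q => //= a p ih q; rewrite inE => /predU1P[->//|/mapP[r /ih sr ->]] /=.
by rewrite sr.
Qed.

Lemma sumn_bumps m p q : q \in bumps m p -> sumn q = (m + sumn p)%N.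
Proof.
elim: p q => //= a p ih q; rewrite inE => /predU1P[->|/mapP[r /ih sr ->]] /=.
  by rewrite addnA.
by rewrite sr addnCA.
Qed.

Lemma all_bumps m p q : all (leq 1) p -> q \in bumps m p -> all (leq 1) q.
Proof.
elim: p q => //= a p ih q /andP[a1 p1]; rewrite inE => /predU1P[->|/mapP[r]].
  by rewrite /= p1 andbT (leq_trans a1) ?leq_addl.
by move=> /ih-/(_ p1) r1 -> /=; rewrite a1.
Qed.

Section AlgebraOfCollisionSums.
Variable R : comNzRingType.
Implicit Types (P : nat -> R) (p : seq nat).

(** For the power sums P m = sum_i s_i ^ m, this is the sum of the products
    s_(i_1) ^ p_1 * ... * s_(i_k) ^ p_k over pairwise distinct indices: when the
    first index runs freely it either avoids the others or merges with one of
    them.  In this form it is a polynomial in the power sums, hence blind to the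
    order of s, continuous and measurable. *)
Fixpoint distinct_sum_rec P (k : nat) (p : seq nat) : R :=
  match k, p with
  | k'.+1, m :: p' =>
      P m * distinct_sum_rec P k' p' -
      \sum_(q <- bumps m p') distinct_sum_rec P k' q
  | _, _ => 1
  end.

Definition distinct_sum P p := distinct_sum_rec P (size p) p.

Lemma distinct_sum_nil P : distinct_sum P [::] = 1.
Proof. by []. Qed.

Lemma distinct_sum_cons P m p : distinct_sum P (m :: p) =
  P m * distinct_sum P p - \sum_(q <- bumps m p) distinct_sum P q.
Proof.
rewrite /distinct_sum /=; congr (_ - _); rewrite big_seq [RHS]big_seq.
by apply: eq_bigr => q /size_bumps ->.
Qed.

(** Induction on the number of parts, so that [bumps] is covered. *)
Lemma size_ind (Q : seq nat -> Prop) :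
  Q [::] -> (forall m p, (forall q, size q = size p -> Q q) -> Q (m :: p)) ->
  forall p, Q p.
Proof.
move=> Q0 QS p; have [k] := ubnP (size p); elim: k p => // k ih [|m p] //= /ltnSE sp.
by apply: QS => q sq; apply: ih; rewrite sq.
Qed.

Lemma distinct_sum_split P m p :
  P m * distinct_sum P p =
  distinct_sum P (m :: p) + \sum_(q <- bumps m p) distinct_sum P q.
Proof. by rewrite distinct_sum_cons subrK. Qed.

Lemma eq_distinct_sum P P' p : (forall m, (0 < m)%N -> P m = P' m) ->
  all (leq 1) p -> distinct_sum P p = distinct_sum P' p.
Proof.
move=> PP'; elim/size_ind: p => // m p ih /= /andP[m1 p1].
rewrite !distinct_sum_cons PP'// ih//; congr (_ - _).
rewrite big_seq [RHS]big_seq; apply: eq_bigr => q qb.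
by rewrite ih// ?(size_bumps qb)// (all_bumps p1 qb).
Qed.

Lemma distinct_sum_scale P c p :
  distinct_sum (fun m => c ^+ m * P m) p = c ^+ sumn p * distinct_sum P p.
Proof.
elim/size_ind: p => [|m p ih]; first by rewrite expr0 mul1r.
rewrite !distinct_sum_cons ih//= mulrBr exprD; congr (_ - _); first by ring.
rewrite mulr_sumr big_seq [RHS]big_seq; apply: eq_bigr => q qb.
by rewrite ih ?(size_bumps qb)// (sumn_bumps qb) exprD.
Qed.

(** Bumping an entry and then deleting one deletes either the bumped entry or
    another one. *)
Lemma sum_bumps_deletions (f : nat -> seq nat -> R) m p :
  \sum_(q <- bumps m p) \sum_(x <- deletions q) f x.1 x.2 =
  \sum_(x <- deletions p)
    (f (m + x.1)%N x.2 + \sum_(q <- bumps m x.2) f x.1 q).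
Proof.
elim: p f => [|a p ih] f /=; first by rewrite !big_nil.
rewrite !big_cons /= !big_map /=.
under [X in _ + X = _]eq_bigr do rewrite /= big_cons big_map /=.
rewrite big_split /= (ih (fun b q => f b (a :: q))) -!addrA; congr (_ + _).
rewrite [LHS]addrCA; congr (_ + _).
rewrite -big_split /=; apply: eq_bigr => x _; rewrite big_cons big_map /=; ring.
Qed.

(** At most one of the indices of a distinct sum hits an added atom [x]. *)
Lemma distinct_sum_add_atom P x p :
  distinct_sum (fun m => P m + x ^+ m) p =
  distinct_sum P p + \sum_(d <- deletions p) x ^+ d.1 * distinct_sum P d.2.
Proof.
elim/size_ind: p => [|m p ih]; first by rewrite big_nil addr0.
rewrite distinct_sum_cons ih//.
rewrite (eq_big_seq (fun q => distinct_sum P q +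
  \sum_(d <- deletions q) x ^+ d.1 * distinct_sum P d.2)); last first.
  by move=> q qb; rewrite ih ?(size_bumps qb).
rewrite big_split /= (sum_bumps_deletions (fun a q => x ^+ a * distinct_sum P q)).
rewrite big_split /= big_cons big_map /= distinct_sum_cons.
under [X in _ = _ + (_ + X)]eq_bigr do
  rewrite distinct_sum_cons mulrBr mulr_sumr.
rewrite big_split /= sumrN.
under [X in _ - (_ + (X + _))]eq_bigr do rewrite exprD -mulrA.
rewrite -mulr_sumr.
under [X in _ = _ + (_ + (X - _))]eq_bigr do rewrite mulrCA.
rewrite -mulr_sumr; ring.
Qed.

(** Without any atom only the empty product is left. *)
Lemma distinct_sum0 p : distinct_sum (fun _ => 0) p = (p == [::])%:R.
Proof.
elim/size_ind: p => // m p ih; rewrite distinct_sum_cons mul0r sub0r.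
rewrite big_seq big1 ?oppr0// => q qb; have sq := size_bumps qb.
by rewrite ih//; case: q p sq qb {ih} => [|//] [].
Qed.

End AlgebraOfCollisionSums.

(** * Rising factorials and Pitman's formula *)

Section DeletionLemmas.
Implicit Types p : seq nat.

Lemma deletionsP p d : d \in deletions p ->
  [/\ (size d.2).+1 = size p, (d.1 + sumn d.2)%N = sumn p &
      all (leq 1) p = (0 < d.1)%N && all (leq 1) d.2].
Proof.
elim: p d => //= a p ih d; rewrite inE => /predU1P[->//|/mapP[e /ih[s1 s2 s3] ->]] /=.
by rewrite s1 addnCA s2 s3 andbCA.
Qed.

Lemma sum_deletions (R : nmodType) (f : nat -> R) p :
  \sum_(d <- deletions p) f d.1 = \sum_(a <- p) f a.
Proof.
by elim: p => /= [|a p ih]; rewrite ?big_nil// !big_cons big_map /= ih.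
Qed.

Lemma prod_deletions (R : comNzRingType) (f : nat -> R) p d :
  d \in deletions p -> f d.1 * \prod_(a <- d.2) f a = \prod_(a <- p) f a.
Proof.
elim: p d => //= a p ih d; rewrite inE => /predU1P[->|/mapP[e /ih E ->]] /=.
  by rewrite big_cons.
by rewrite !big_cons mulrCA E.
Qed.

End DeletionLemmas.

Section RisingFactorial.
Variable R : realFieldType.
Implicit Types (x a b c : R) (p : seq nat).

Definition rising x n : R := \prod_(i < n) (x + i%:R).

Lemma rising0 x : rising x 0 = 1.
Proof. by rewrite /rising big_ord0. Qed.

Lemma rising1 x : rising x 1 = x.
Proof. by rewrite /rising big_ord1 addr0. Qed.

Lemma risingSr x n : rising x n.+1 = rising x n * (x + n%:R).
Proof. by rewrite /rising big_ord_recr. Qed.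

Lemma risingD x m n : rising x (m + n) = rising x m * rising (x + m%:R) n.
Proof.
elim: n => [|n ih]; first by rewrite addn0 rising0 mulr1.
by rewrite addnS !risingSr ih natrD; ring.
Qed.

Lemma risingSl x n : rising x n.+1 = x * rising (x + 1) n.
Proof. by rewrite -add1n risingD rising1. Qed.

Lemma rising_gt0 x n : 0 < x -> 0 < rising x n.
Proof. by move=> x0; apply: prodr_gt0 => i _; rewrite ltr_wpDr. Qed.

Lemma ltr_rising x y n : (0 < n)%N -> 0 < x -> x < y -> rising x n < rising y n.
Proof.
case: n => // n _ x0 xy; elim: n => [|n ih]; first by rewrite !rising1.
rewrite 2![rising _ n.+2]risingSr ltr_pM ?ltrD2r// ?ltW ?rising_gt0//.
by rewrite ltr_wpDr.
Qed.

Lemma rising_addn a n : rising (a + 1) n - rising a n = n%:R * rising (a + 1) n.-1.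
Proof.
case: n => [|n]; first by rewrite !rising0 subrr mul0r.
by rewrite risingSr risingSl /= -natr1; ring.
Qed.

(** The Chu-Vandermonde identity, in the form of the moments
    E[(1 - B)^m] of a beta variable B with parameters a and c - a. *)
Lemma chu_vandermonde a c m : 0 < c ->
  \sum_(r < m.+1) (-1) ^+ r * 'C(m, r)%:R * (rising a r / rising c r) =
  rising (c - a) m / rising c m.
Proof.
elim: m a c => [|m ih] a c c0.
  by rewrite big_ord1 bin0 !rising0 expr0 !mul1r.
have T : \sum_(r < m.+2) (-1) ^+ r * 'C(m.+1, r)%:R * (rising a r / rising c r) =
    \sum_(r < m.+1) (-1) ^+ r * 'C(m, r)%:R * (rising a r / rising c r) -
    a / c * \sum_(r < m.+1) (-1) ^+ r * 'C(m, r)%:R *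
      (rising (a + 1) r / rising (c + 1) r).
  rewrite big_ord_recl bin0 expr0 /=.
  under eq_bigr => i _.
    rewrite /bump /= add1n binS natrD mulrDr mulrDl; over.
  rewrite big_split /= addrA; congr (_ + _).
    rewrite [RHS]big_ord_recl bin0 expr0; congr (_ + _).
    rewrite big_ord_recr /= (bin_small (ltnSn m)) mulr0 mul0r addr0.
    by apply: eq_bigr => i _.
  rewrite mulr_sumr -sumrN; apply: eq_bigr => i _.
  rewrite exprS !risingSl invfM; ring.
rewrite T ih// ih ?addr_gt0//.
have -> : c + 1 - (a + 1) = c - a by ring.
have e : c * rising (c + 1) m = rising c m * (c + m%:R).
  by rewrite -risingSl risingSr.
rewrite [rising (c - a) m.+1]risingSr [rising c m.+1]risingSr.
have r0 : rising c m != 0 by rewrite gt_eqF// rising_gt0.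
have c1 : rising (c + 1) m != 0 by rewrite gt_eqF// rising_gt0// addr_gt0.
have cm : c + m%:R != 0 by rewrite gt_eqF// ltr_wpDr.
have -> : (rising (c + 1) m) = rising c m * (c + m%:R) / c.
  by rewrite -e mulrAC divff ?mul1r// gt_eqF.
have cn : c != 0 by rewrite gt_eqF.
by field; rewrite cm r0.
Qed.

End RisingFactorial.

Section PitmanFormula.
Variable R : realFieldType.
Variable alpha : R.
Hypothesis alpha_lt1 : alpha < 1.
Implicit Types (theta : R) (p : seq nat).

(** Pitman's partition probability function.  The common factor theta of
    numerator and denominator is cancelled, as it may be zero or negative. *)
Definition eppf theta p : R :=
  \prod_(i < (size p).-1) (theta + i.+1%:R * alpha) *
  \prod_(a <- p) rising (1 - alpha) a.-1 / rising (theta + 1) (sumn p).-1.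

Lemma eppf_nil theta : eppf theta [::] = 1.
Proof. by rewrite /eppf /= big_ord0 big_nil rising0 !mul1r invr1. Qed.

Let fall_gt0 n : 0 < rising (1 - alpha) n.
Proof. by rewrite rising_gt0// subr_gt0. Qed.

Lemma weight_gt0 theta i : 0 <= alpha -> - alpha < theta ->
  0 < theta + i.+1%:R * alpha.
Proof.
move=> a0 ta; rewrite -natr1 mulrDl mul1r; rewrite addrCA.
by rewrite ltr_wpDl ?mulr_ge0// -ltrBlDr sub0r.
Qed.

Lemma eppf_gt0 theta p : 0 <= alpha -> - alpha < theta -> 0 < eppf theta p.
Proof.
move=> a0 ta; rewrite /eppf divr_gt0//; first rewrite mulr_gt0//.
- by apply: prodr_gt0 => i _; exact: weight_gt0.
- by apply: prodr_gt0.
- by apply/rising_gt0; rewrite -ltrBlDr sub0r (lt_trans _ ta)// ltrN2.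
Qed.

Lemma sumn_gt0 p : all (leq 1) p -> p != [::] -> (0 < sumn p)%N.
Proof. by case: p => // a p /andP[a1 _] _ /=; rewrite ltn_addr. Qed.

Lemma rising_fall a m : (0 < a)%N -> rising (1 - alpha) (m + a).-1 =
  rising (1 - alpha) a.-1 * rising (a%:R - alpha) m.
Proof.
case: a => // a _; rewrite addnS /= addnC risingD; congr (_ * rising _ _).
by rewrite -natr1; ring.
Qed.

Section theta.
Variable theta : R.
Hypothesis alpha_ge0 : 0 <= alpha.
Hypothesis theta_gt : - alpha < theta.

Lemma thetan_gt0 n : (0 < n)%N -> 0 < theta + n%:R.
Proof.
case: n => // n _; rewrite -natr1 addrCA ltr_wpDl// -ltrBlDr sub0r.
by rewrite (lt_trans _ theta_gt)// ltrN2.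
Qed.

Let rising_theta n m : (0 < n)%N ->
  rising (theta + 1) (m + n).-1 = rising (theta + 1) n.-1 * rising (theta + n%:R) m.
Proof.
case: n => // n _; rewrite addnS /= addnC risingD; congr (_ * rising _ _).
by rewrite -natr1; ring.
Qed.

(** Prediction weight of a new species that receives m individuals. *)
Lemma eppf_cons m p : (0 < m)%N -> all (leq 1) p -> p != [::] ->
  eppf theta (m :: p) = eppf theta p * ((theta + (size p)%:R * alpha) *
    rising (1 - alpha) m.-1 / rising (theta + (sumn p)%:R) m).
Proof.
move=> m0 p1 pn; have n0 := sumn_gt0 p1 pn.
rewrite /eppf /= rising_theta// big_cons.
case: p p1 pn n0 => // b p p1 pn n0; rewrite [size (_ :: _)]/= [_.+1.-1]/=.
rewrite big_ord_recr /= !invfM; ring.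
Qed.

(** Prediction weights of the species already discovered. *)
Lemma sum_eppf_bumps m p : all (leq 1) p -> p != [::] ->
  \sum_(q <- bumps m p) eppf theta q = eppf theta p *
    \sum_(a <- p) (rising (a%:R - alpha) m / rising (theta + (sumn p)%:R) m).
Proof.
move=> p1 pn; have n0 := sumn_gt0 p1 pn.
have T s : all (leq 1) s ->
    \sum_(q <- bumps m s) \prod_(a <- q) rising (1 - alpha) a.-1 =
    \prod_(a <- s) rising (1 - alpha) a.-1 * \sum_(a <- s) rising (a%:R - alpha) m.
  elim: s => /= [|a s ih /andP[a0 /ih {}ih]]; first by rewrite !big_nil mulr0.
  rewrite !big_cons big_map; under [X in _ + X]eq_bigr do rewrite big_cons.
  by rewrite -mulr_sumr ih rising_fall//; ring.
rewrite /eppf (eq_big_seq (fun q => \prod_(a <- q) rising (1 - alpha) a.-1 *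
  (\prod_(i < (size p).-1) (theta + i.+1%:R * alpha) /
   rising (theta + 1) (m + sumn p).-1))); last first.
  by move=> q qb; rewrite (size_bumps qb) (sumn_bumps qb); ring.
rewrite -!mulr_suml T// rising_theta// invfM; ring.
Qed.

(** The prediction weights of the next individual add up to one. *)
Lemma eppf_consistent p : all (leq 1) p ->
  eppf theta (1%N :: p) + \sum_(q <- bumps 1 p) eppf theta q = eppf theta p.
Proof.
move=> p1; have [->|pn] := eqVneq p [::].
  by rewrite big_nil addr0 eppf_nil /eppf /= big_ord0 big_seq1 !rising0 !mul1r invr1.
rewrite eppf_cons// sum_eppf_bumps// -mulrDr rising0 rising1 mulr1.
under eq_bigr do rewrite rising1.
rewrite -mulr_suml -mulrDl sumrB big_const_seq count_predT iter_addr_0.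
rewrite -natr_sum -sumnE -mulr_natl.
rewrite (_ : theta + _ + (_ - _) = theta + (sumn p)%:R); last by ring.
rewrite divff ?mulr1//.
by rewrite gt_eqF// thetan_gt0// sumn_gt0.
Qed.

End theta.

(** Breaking off the first stick: it carries none of the k species, which
    leaves all of them to the remaining sticks, or exactly one of them.  Here
    e a b is the moment E[W ^ a * (1 - W) ^ b] of the first stick W, and the
    remaining sticks have parameter theta + alpha. *)
Lemma eppf_recursion theta p : 0 <= alpha -> - alpha < theta ->
  all (leq 1) p -> p != [::] ->
  let e a b := rising (1 - alpha) a * rising (theta + alpha) b /
               rising (theta + 1) (a + b) in
  eppf theta p = e 0 (sumn p) * eppf (theta + alpha) p +
    \sum_(d <- deletions p) e d.1 (sumn d.2) * eppf (theta + alpha) d.2.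
Proof.
move=> a0 ta p1 pn e; have n0 := sumn_gt0 p1 pn.
have ta0 : 0 < theta + alpha by rewrite -ltrBlDr sub0r.
have pos n : rising (theta + alpha + 1) n != 0.
  by rewrite gt_eqF// rising_gt0// addr_gt0.
have shift k : (theta + alpha) * \prod_(i < k) (theta + alpha + i.+1%:R * alpha) =
    \prod_(i < k.+1) (theta + i.+1%:R * alpha).
  rewrite [RHS]big_ord_recl mul1r; congr (_ * _).
  by apply: eq_bigr => i _; rewrite lift0 -[in RHS]natr1; ring.
(* The common factor of all the terms; the cofactors are theta + k * alpha and
   d.1 - alpha, which add up to theta + n. *)
pose C := \prod_(i < (size p).-1) (theta + i.+1%:R * alpha) *
  \prod_(a <- p) rising (1 - alpha) a.-1 / rising (theta + 1) (sumn p).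
have E0 : e 0%N (sumn p) * eppf (theta + alpha) p =
    C * (theta + (size p)%:R * alpha).
  rewrite /e /eppf /C rising0 mul1r add0n.
  case: p p1 pn n0 => // b p p1 pn n0 in C *; set q := b :: p in C n0 *.
  rewrite [X in X * (_ / _)](_ : _ = (theta + alpha) *
    rising (theta + alpha + 1) (sumn q).-1 / rising (theta + 1) (sumn q)); last first.
    by rewrite -risingSl prednK.
  have := shift (size p); rewrite big_ord_recr /= => E.
  transitivity ((theta + alpha) * \prod_(i < size p) (theta + alpha + i.+1%:R * alpha) *
    \prod_(a <- q) rising (1 - alpha) a.-1 / rising (theta + 1) (sumn q) *
    (rising (theta + alpha + 1) (sumn q).-1 / rising (theta + alpha + 1) (sumn q).-1)).
    by rewrite /=; ring.
  by rewrite divff// mulr1 E; ring.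
have Ed d : d \in deletions p ->
    e d.1 (sumn d.2) * eppf (theta + alpha) d.2 = C * (d.1%:R - alpha).
  move=> dp; have [s1 s2 s3] := deletionsP dp.
  have /andP[d0 d1] : (0 < d.1)%N && all (leq 1) d.2 by rewrite -s3.
  rewrite /e /C -s1 s2 -(prod_deletions (fun a => rising (1 - alpha) a.-1) dp).
  have := @rising_fall d.1 1 d0; rewrite rising1 add1n [_.+1.-1]/= => ->.
  have [dn|dn] := eqVneq d.2 [::].
    rewrite dn eppf_nil /= big_ord0 big_nil rising0; ring.
  have m0 := sumn_gt0 d1 dn.
  rewrite /eppf -[X in rising (theta + alpha) X](prednK m0) risingSl.
  rewrite [(size d.2).+1.-1]/= -[size d.2 in RHS](@prednK (size d.2)); last first.
    by case: (d.2) dn.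
  rewrite -shift; set x := rising (theta + alpha + 1) _.
  have x0 : x != 0 by exact: pos.
  transitivity ((theta + alpha) * \prod_(i < (size d.2).-1) (theta + alpha + i.+1%:R * alpha) *
     (rising (1 - alpha) d.1.-1 * \prod_(a <- d.2) rising (1 - alpha) a.-1) /
     rising (theta + 1) (sumn p) * (d.1%:R - alpha) * (x / x)); first by ring.
  by rewrite divff// mulr1.
rewrite E0 (eq_big_seq _ Ed) -mulr_sumr (sum_deletions (fun a => a%:R - alpha)).
rewrite sumrB big_const_seq count_predT iter_addr_0 -natr_sum -sumnE -mulr_natl.
rewrite -mulrDr (_ : theta + _ + (_ - _) = theta + (sumn p)%:R); last by ring.
have t0 := thetan_gt0 ta n0.
have E : rising (theta + 1) (sumn p) =
    rising (theta + 1) (sumn p).-1 * (theta + (sumn p)%:R).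
  by rewrite -[in LHS](prednK n0) risingSr -addrA nat1r prednK.
rewrite /C /eppf E invfM -!mulrA mulVf ?mulr1// gt_eqF//.
Qed.

End PitmanFormula.

(** * Logarithmic moments of the beta laws *)

Section LogarithmicMoments.
Variable R : realType.
Implicit Types a b x : R.

Lemma rising_ratio_le1 a x n : 0 <= a -> 0 < x -> rising x n / rising (x + a) n <= 1.
Proof.
move=> a0 x0; have xa : 0 < x + a by rewrite ltr_wpDr.
rewrite ler_pdivrMr ?rising_gt0// mul1r.
elim: n => [|n ih]; first by rewrite !rising0.
rewrite !risingSr ler_pM ?lerD2r ?lerDl//; first exact/ltW/rising_gt0.
by rewrite ltW// ltr_wpDr.
Qed.

(** The inverse ratio dominates a multiple of the harmonic series. *)
Lemma rising_ratio_cvg0 a x : 0 < a -> 0 < x ->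
  rising x n / rising (x + a) n @[n --> \oo] --> 0.
Proof.
move=> a0 x0; have xa : 0 < x + a by rewrite addr_gt0.
pose c := a / (x + 1); have c0 : 0 < c by rewrite divr_gt0// addr_gt0.
have le n : c * series harmonic n <= rising (x + a) n / rising x n.
  suff: 1 + c * series harmonic n <= rising (x + a) n / rising x n.
    by apply: le_trans; rewrite lerDr.
  elim: n => [|n ih].
    by rewrite /series /= big_geq// mulr0 addr0 !rising0 divr1.
  have xn : 0 < x + n%:R by rewrite ltr_wpDr.
  have h0 : 0 <= series harmonic n :> R.
    by rewrite /series /= sumr_ge0// => i _; rewrite invr_ge0.
  have step : c / n.+1%:R <= a / (x + n%:R).
    have p1 : 0 < (x + 1) * n.+1%:R by apply: mulr_gt0; [exact: addr_gt0|].
    rewrite /c -mulrA ler_pM2l// -invfM lef_pV2 ?posrE//.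
    by rewrite -natr1; have : 0 <= n%:R :> R by []; nra.
  rewrite !risingSr -mulf_div.
  have -> : (x + a + n%:R) / (x + n%:R) = 1 + a / (x + n%:R).
    by field; rewrite gt_eqF.
  rewrite /series /= big_nat_recr//= mulrDr.
  apply: (@le_trans _ _ ((1 + c * series harmonic n) * (1 + a / (x + n%:R)))).
    rewrite mulrDr mulr1 mulrDl mul1r addrA lerD2l.
    by rewrite ler_wpDr// mulr_ge0//; [apply: mulr_ge0 => //; exact: ltW|exact/ltW/divr_gt0].
  by rewrite ler_wpM2r// addr_ge0// divr_ge0// ltW.
have H : c * series harmonic n @[n --> \oo] --> +oo.
  have /cvgryPge h : (series harmonic n : R) @[n --> \oo] --> +oo.
    apply: nondecreasing_dvgn_lt; last exact: dvg_harmonic.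
    by apply: nondecreasing_series => n _ _; exact: harmonic_ge0.
  apply/cvgryPge => A; near=> n; rewrite -ler_pdivrMl//; near: n; exact: h.
apply/cvgr0Pnorm_le => e e0; near=> n.
have r1 : 0 < rising x n by rewrite rising_gt0.
have r2 : 0 < rising (x + a) n by rewrite rising_gt0.
rewrite ger0_norm; last by rewrite ltW// divr_gt0.
rewrite -invf_div invf_ple ?posrE ?divr_gt0//.
apply: le_trans (le n); near: n; move/cvgryPge : H; exact.
Unshelve. all: by end_near. Qed.

Definition log_moment_term a b m : R :=
  m.+1%:R^-1 * (rising b m.+1 / rising (a + b) m.+1).

(** Equal to E[- ln B] for a beta variable B with parameters a and b, by the
    expansion - ln B = sum_m (1 - B) ^ m / m; in terms of the digamma function
    it is psi (a + b) - psi a. *)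
Definition log_moment a b : R := limn (series (log_moment_term a b)).

Lemma log_moment_term_ge0 a b m : 0 < a -> 0 < b -> 0 <= log_moment_term a b m.
Proof.
by move=> a0 b0; rewrite mulr_ge0 ?invr_ge0// divr_ge0// ltW// rising_gt0// addr_gt0.
Qed.

(** Up to a constant factor, the terms are bounded by those of a telescoping
    series. *)
Lemma is_cvg_log_moment a b : 0 < a -> 0 < b ->
  cvgn (series (log_moment_term a b)).
Proof.
move=> a0 b0; apply: nondecreasing_is_cvgn.
  by apply: nondecreasing_series => n _ _; exact: log_moment_term_ge0.
have ab0 : 0 < a + b by rewrite addr_gt0.
pose r m := rising b m / rising (a + b) m.
have r0 m : 0 <= r m by rewrite ltW// divr_gt0// rising_gt0.
exists ((a + b + 1) / a) => _ [n _ <-] /=.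
have tel m : a / (a + b + m%:R) * r m = r m - r m.+1.
  rewrite /r !risingSr; have : 0 < rising (a + b) m by rewrite rising_gt0.
  have : 0 < a + b + m%:R by rewrite ltr_wpDr.
  by move=> h1 h2; field; rewrite !gt_eqF.
apply: (@le_trans _ _ ((a + b + 1) / a * \sum_(0 <= m < n) (r m.+1 - r m.+2))).
  rewrite mulr_sumr; apply: ler_sum => m _; rewrite -tel /log_moment_term -/(r m.+1).
  rewrite mulrA ler_wpM2r//.
  rewrite mulrA divfK ?gt_eqF// ler_pdivlMr; last by rewrite ltr_wpDr.
  by rewrite mulrC ler_pdivrMr// -natr1; have : 0 <= (m%:R : R) by []; nra.
have c0 : 0 <= (a + b + 1) / a by rewrite ltW// divr_gt0// addr_gt0.
rewrite -[leRHS]mulr1 ler_wpM2l//.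
under eq_bigr do rewrite -opprB; rewrite sumrN.
rewrite (telescope_sumr (fun m => r m.+1))// opprB.
rewrite lerBlDr (le_trans (_ : _ <= 1))//; last by rewrite lerDl.
by rewrite /r addrC rising_ratio_le1// ltW.
Qed.

(** The difference is a telescoping series; this is the recursion
    psi (a + 1) = psi a + 1 / a of the digamma function. *)
Lemma log_moment_shift a b : 0 < a -> 0 < b ->
  log_moment a (b + 1) = log_moment (a + 1) b + a^-1.
Proof.
move=> a0 b0; have b1 : 0 < b + 1 by rewrite addr_gt0.
have a1 : 0 < a + 1 by rewrite addr_gt0.
pose r m := rising (b + 1) m / rising (b + 1 + a) m.
suff T : series (log_moment_term a (b + 1)) n - series (log_moment_term (a + 1) b) n
    @[n --> \oo] --> a^-1.
  have C := cvgB (is_cvg_log_moment a0 b1) (is_cvg_log_moment a1 b0).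
  by rewrite (cvg_unique (@norm_hausdorff _ _) T (C _)) /log_moment [RHS]addrC subrK.
have E n : series (log_moment_term a (b + 1)) n - series (log_moment_term (a + 1) b) n =
    a^-1 * (r 0%N - r n).
  rewrite /series /= -sumrB -opprB -telescope_sumr// -sumrN mulr_sumr; apply: eq_big_nat => m _.
  rewrite opprB /log_moment_term /r.
  have -> : a + (b + 1) = b + 1 + a by ring.
  have -> : a + 1 + b = b + 1 + a by ring.
  rewrite -mulrBr -mulrBl rising_addn /= 2!risingSr.
  have : 0 < rising (b + 1 + a) m by rewrite rising_gt0// addr_gt0.
  have : 0 < b + 1 + a + m%:R by rewrite ltr_wpDr// addr_gt0.
  have : 0 < m%:R + 1 :> R by rewrite ltr_wpDl.
  by move=> h1 h2 h3; rewrite -natr1; field; rewrite !gt_eqF.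
rewrite (funext E).
suff : a^-1 * (r 0%N - r n) @[n --> \oo] --> a^-1 * (1 - 0) by rewrite subr0 mulr1.
have r0 : r 0%N = 1 by rewrite /r !rising0 divr1.
apply: cvgMr; apply: cvgB; first by rewrite r0; exact: cvg_cst.
exact: rising_ratio_cvg0.
Qed.

Lemma log_momentE a b : 0 < a -> 0 < b ->
  (\sum_(0 <= m <oo) (log_moment_term a b m)%:E)%E = (log_moment a b)%:E.
Proof.
move=> a0 b0; rewrite /log_moment -EFin_lim; last exact: is_cvg_log_moment.
by congr (limn _); apply/funext => n /=; rewrite sumEFin.
Qed.

Lemma geometric_partial_sum x n : x * \sum_(m < n) (1 - x) ^+ m = 1 - (1 - x) ^+ n.
Proof.
elim: n => [|n ih]; first by rewrite big_ord0 mulr0 subrr.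
by rewrite big_ord_recr mulrDr ih exprS; ring.
Qed.

(** Mean value theorem for the remainder f of the logarithmic series: its
    derivative is - (1 - y) ^ n / y, and f 1 = 0. *)
Lemma log_series_le x n : 0 < x -> x <= 1 ->
  0 <= - ln x - \sum_(m < n) (1 - x) ^+ m.+1 / m.+1%:R <= (1 - x) ^+ n / x.
Proof.
move=> x0 x1.
pose g n y : R := \sum_(m < n) (1 - y) ^+ m.+1 / m.+1%:R.
have dg k y : is_derive y (1 : R) (g k) (- \sum_(m < k) (1 - y) ^+ m).
  elim: k => [|k ih].
    rewrite big_ord0 oppr0 (_ : g 0%N = cst 0); first exact: is_derive_cst.
    by apply/funext => z; rewrite /g big_ord0.
  rewrite (_ : g k.+1 = g k + (fun z => (1 - z) ^+ k.+1 / k.+1%:R)); last first.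
    by apply/funext => z; rewrite /g big_ord_recr.
  have h : is_derive y (1 : R) (fun z => (1 - z) ^+ k.+1 / k.+1%:R) (- (1 - y) ^+ k).
    have dZ := is_deriveZ k.+1%:R^-1 (is_deriveX k.+1
      (is_deriveB (is_derive_cst (1 : R) y 1) (is_derive_id y (1 : R)))).
    rewrite (_ : (fun z => _) = k.+1%:R^-1 \*: ((cst 1 - id : R -> R) ^+ k.+1)).
      apply: is_derive_eq dZ _; rewrite /GRing.scale /= !fctE /=.
      by rewrite -natr1; field; rewrite gt_eqF// ltr_wpDl.
    by apply/funext => z; rewrite /= !fctE mulrC.
  rewrite big_ord_recr /= opprD; exact: is_deriveD.
pose f (y : R) : R := - ln y - g n y.
have df (y : R) : 0 < y -> is_derive y (1 : R) f (- ((1 - y) ^+ n / y)).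
  move=> y0; apply: is_derive_eq.
    by apply: is_deriveB; first exact/is_deriveN/is_derive1_ln.
  rewrite opprK -[X in _ + X](mulKf (lt0r_neq0 y0)) geometric_partial_sum.
  by field; rewrite gt_eqF.
have [c cx] : exists2 c, c \in `[x, 1]%R &
    f 1 - f x = - ((1 - c) ^+ n / c) * (1 - x).
  apply: MVT_segment => //.
    by move=> y; rewrite in_itv /= => /andP[xy _]; apply: df; exact: lt_trans xy.
  apply: derivable_within_continuous => y; rewrite in_itv /= => /andP[xy _].
  by have [] := df y (lt_le_trans x0 xy).
have -> : f 1 = 0.
  rewrite /f ln1 /g big1 ?subr0 ?oppr0// => i _.
  by rewrite subrr exprS !mul0r.
rewrite sub0r mulNr => /oppr_inj; rewrite -/(g n x) -/(f x) => ->.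
move: cx; rewrite in_itv /= => /andP[xc c1].
have c0 : 0 < c by exact: lt_le_trans xc.
have q0 : 0 <= (1 - c) ^+ n / c by rewrite divr_ge0 ?exprn_ge0 ?subr_ge0// (ltW c0).
have x1' : 0 <= 1 - x by rewrite subr_ge0.
apply/andP; split; first exact: mulr_ge0.
rewrite -[leRHS]mulr1 ler_pM//; last by rewrite gerBl (ltW x0).
rewrite ler_pM ?exprn_ge0 ?invr_ge0 ?subr_ge0 ?(ltW c0) ?lef_pV2 ?posrE//.
by apply: lerXn2r; rewrite ?nnegrE ?subr_ge0// lerD2l lerN2.
Qed.

Lemma entropy_termE x : 0 <= x <= 1 ->
  (- (x * ln x))%:E =
  (\sum_(0 <= m <oo) (m.+1%:R^-1 * (x * (1 - x) ^+ m.+1))%:E)%E.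
Proof.
move=> /andP[]; rewrite le_eqVlt => /predU1P[<- _|x0 x1].
  rewrite mul0r oppr0 eseries0// => i _ _; by rewrite mul0r mulr0.
apply/esym/cvg_lim => //.
apply: cvg_trans; first apply: near_eq_cvg; first by near=> n; rewrite sumEFin.
apply: cvg_EFin; first by near=> n.
rewrite (_ : _ \o _ = fun n => x * \sum_(m < n) (1 - x) ^+ m.+1 / m.+1%:R); last first.
  by apply/funext => n /=; rewrite big_mkord mulr_sumr; apply: eq_bigr => i _; ring.
rewrite -mulrN; apply: cvgMr.
apply/subr_cvg0/cvgr0Pnorm_le => e e0.
have c0 : (1 - x) ^+ n / x @[n --> \oo] --> 0.
  suff : (1 - x) ^+ n / x @[n --> \oo] --> 0 / x by rewrite mul0r.
  apply: cvgMl; apply: cvg_expr.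
  by rewrite ger0_norm ?subr_ge0// gtrBl.
move/cvgr0Pnorm_le : c0 => /(_ _ e0) c0; near=> n.
have /andP[h1 h2] := log_series_le n x0 x1.
rewrite -normrN opprB ger0_norm// (le_trans h2)// (le_trans (ler_norm _))//.
by near: n; exact: c0.
Unshelve. all: by end_near. Qed.

End LogarithmicMoments.

(** * Change of measure and independence *)

Section ChangeOfMeasure.
Local Open Scope ereal_scope.
Context d1 d2 (T1 : measurableType d1) (T2 : measurableType d2) (R : realType).
Variables (mu : {measure set T1 -> \bar R}) (nu : {measure set T2 -> \bar R}).
Variables (phi : T1 -> T2) (w : T1 -> R).
Hypotheses (mphi : measurable_fun setT phi) (mw : measurable_fun setT w).
Hypothesis w0 : forall x, (0 <= w x)%R.
Hypothesis nuE : forall A, measurable A ->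
  nu A = \int[mu]_(x in phi @^-1` A) (w x)%:E.

Import HBNNSimple.

Lemma integral_weighted_nnsfun (h : {nnsfun T2 >-> R}) :
  \int[nu]_y (h y)%:E = \int[mu]_x ((w x)%:E * (h (phi x))%:E).
Proof.
rewrite integralT_nnsfun sintegralE.
transitivity (\int[mu]_x (\sum_(k \in range h)
    (k%:E * ((w x)%:E * (\1_(phi @^-1` (h @^-1` [set k])) x)%:E)))); last first.
  apply: eq_integral => x _; rewrite (fimfunE h (phi x)) -fsumEFin//.
  rewrite ge0_mule_fsumr; last by move=> k; exact: nnfun_muleindic_ge0.
  by apply: eq_fsbigr => k _; rewrite EFinM muleCA.
have mk k : measurable (phi @^-1` (h @^-1` [set k])).
  by rewrite -[X in measurable X]setTI; exact: mphi.
have mI k : measurable_fun setT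
    (fun x => (w x)%:E * (\1_(phi @^-1` (h @^-1` [set k])) x)%:E).
  by apply/measurable_EFinP; apply: measurable_funM.
rewrite ge0_integral_fsum//; last 2 first.
- move=> k; apply: measurable_funeM. exact: (mI k).
- move=> k x _; rewrite muleCA mule_ge0 ?lee_fin//.
  exact: (nnfun_muleindic_ge0 h k (phi x)).
apply: eq_fsbigr => k; rewrite inE => -[y _ <-].
rewrite ge0_integralZl ?lee_fin//; last first.
  by move=> x _; rewrite mule_ge0// lee_fin.
congr (_ * _); rewrite nuE// integral_mkcond.
apply: eq_integral => x _; rewrite patchE indicE.
by case: ifPn => _; rewrite ?mule1 ?mule0.
Qed.

(** The image by phi of the measure with density w: the rule on sets extends to
    functions.  It covers densities (phi the identity) and the factorization of
    expectations (w a function of other variables). *)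
Lemma integral_weighted (f : T2 -> \bar R) : measurable_fun setT f ->
  (forall y, 0 <= f y) ->
  \int[nu]_y f y = \int[mu]_x ((w x)%:E * f (phi x)).
Proof.
move=> mf f0; pose f_ := nnsfun_approx measurableT mf.
have cf y : (f_ n y)%:E @[n --> \oo] --> f y by exact: cvg_nnsfun_approx.
transitivity (limn (fun n => \int[nu]_y (f_ n y)%:E)).
  rewrite -monotone_convergence//.
  - by apply: eq_integral => y _; apply/esym/cvg_lim => //; exact: cf.
  - by move=> n; exact/measurable_EFinP/measurable_funP.
  - by move=> n y _; rewrite lee_fin.
  - by move=> y _ m n mn; rewrite lee_fin; exact/lefP/nd_nnsfun_approx.
transitivity (limn (fun n => \int[mu]_x ((w x)%:E * (f_ n (phi x))%:E))).
  by congr (limn _); apply/funext => n; exact: integral_weighted_nnsfun.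
rewrite -monotone_convergence//.
- by apply: eq_integral => x _; apply/cvg_lim => //; apply: cvgeZl.
- move=> n; apply: emeasurable_funM; apply/measurable_EFinP => //.
  exact: measurableT_comp.
- by move=> n x _; rewrite mule_ge0 ?lee_fin.
- by move=> x _ m n mn; rewrite lee_wpmul2l ?lee_fin//; exact/lefP/nd_nnsfun_approx.
Qed.

End ChangeOfMeasure.

Section IndependentProducts.
Context d (T : measurableType d) (R : realType) (Q : probability T R).
Variables (W : nat -> {RV Q >-> R}) (f : nat -> R -> R) (e : nat -> R).
Hypothesis W_indep : mutually_independent W.
Hypothesis mf : forall j, measurable_fun setT (f j).
Hypothesis f0 : forall j x, 0 <= f j x.
Hypothesis fe : forall j, (\int[Q]_w (f j (W j w))%:E = (e j)%:E)%E.

Let prefix k w := \prod_(j < k) f j (W j w).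

Let mprefix k : measurable_fun setT (prefix k).
Proof. by apply: measurable_prod => j _; exact: measurableT_comp. Qed.

Let prefix_ge0 k w : 0 <= prefix k w.
Proof. by apply: prodr_ge0. Qed.

Let e_ge0 j : 0 <= e j.
Proof. by rewrite -lee_fin -fe; apply: integral_ge0 => w _; rewrite lee_fin. Qed.

Let cyl (J : seq nat) (A : nat -> set R) := \bigcap_(j in [set` J]) (W j @^-1` A j).

Let mW j (A : set R) : measurable A -> measurable (W j @^-1` A).
Proof. by move=> mA; exact: measurable_sfunP. Qed.

Let mcyl J A : (forall j, measurable (A j)) -> measurable (cyl J A).
Proof. by move=> mA; apply: fin_bigcap_measurable => // j _; exact: mW. Qed.

Let cylS k J A : cyl (k :: J) A = W k @^-1` A k `&` cyl J A.
Proof.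
by rewrite /cyl !bigcap_seq big_cons.
Qed.

(** The functions replace the indicators of the product rule one by one. *)
Lemma independent_prefix k J A : uniq J -> {in J, forall j, (k <= j)%N} ->
  (forall j, measurable (A j)) ->
  (\int[Q]_(w in cyl J A) (prefix k w)%:E = (\prod_(j < k) e j)%:E * Q (cyl J A))%E.
Proof.
elim: k J A => [|k ih] J A uJ kJ mA.
  rewrite big_ord0 mul1e -[RHS]mul1e -integral_cst//; last exact: mcyl.
  by apply: eq_integral => w _; rewrite /prefix big_ord0.
have kNJ : k \notin J by apply/negP => /kJ; rewrite ltnn.
(* As a function of the set in which W k falls, the integral of w1 is c times
   the law of W k. *)
pose c : R := \prod_(j < k) e j * fine (Q (cyl J A)).
have c0 : 0 <= c by rewrite mulr_ge0 ?prodr_ge0// fine_ge0.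
have QJ : Q (cyl J A) = (fine (Q (cyl J A)))%:E by rewrite fineK// fin_num_measure//; exact: mcyl.
pose w1 w := prefix k w * \1_(cyl J A) w.
have mw1 : measurable_fun setT w1.
  by apply: measurable_funM => //; apply: measurable_indic; exact: mcyl.
have w10 w : 0 <= w1 w by rewrite mulr_ge0.
have nuE B : measurable B -> mscale (NngNum c0) (distribution Q (W k)) B =
    (\int[Q]_(w in W k @^-1` B) (w1 w)%:E)%E.
  move=> mB; pose A' j := if j == k then B else A j.
  have mA' j : measurable (A' j) by rewrite /A'; case: ifP.
  have E : cyl (k :: J) A' = W k @^-1` B `&` cyl J A.
    rewrite cylS {1}/A' eqxx; congr (_ `&` _); apply: eq_bigcapr => j /= jJ.
    by rewrite /A'; case: eqP => // jk; rewrite jk (negbTE kNJ) in jJ.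
  transitivity (\int[Q]_(w in cyl (k :: J) A') (prefix k w)%:E)%E; last first.
    rewrite E integral_mkcondr; apply: eq_integral => w _.
    rewrite patchE /w1 indicE; case: ifPn => _; first by rewrite mulr1.
    by rewrite mulr0.
  rewrite ih//; last 2 first.
  - by rewrite /= kNJ.
  - by move=> j; rewrite inE => /predU1P[->//|/kJ/ltnW].
  rewrite (W_indep (J := k :: J))//; last by rewrite /= kNJ.
  rewrite big_cons {1}/A' eqxx /mscale /= /c EFinM -QJ -muleA; congr (_ * _)%E.
  rewrite muleC; congr (_ * _)%E.
  rewrite (W_indep uJ mA); apply: eq_big_seq => j jJ; rewrite /A'.
  by case: eqP => // jk; rewrite -jk jJ in kNJ.
have mfk : measurable_fun setT (EFin \o f k) by exact/measurable_EFinP.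
have := integral_weighted (measurable_funPT (W k)) mw1 w10 nuE mfk (fun y => f0 k y).
rewrite ge0_integral_mscale; [|by []|by []|by move=> x _; rewrite lee_fin f0].
rewrite ge0_integral_distribution//=; last by move=> y; rewrite lee_fin.
rewrite fe => H.
rewrite big_ord_recr /= QJ -EFinM mulrAC EFinM -[X in (X * _)%E]/(c%:E) H.
rewrite integral_mkcond; apply: eq_integral => w _.
rewrite patchE /w1 indicE /prefix big_ord_recr /=; case: ifPn => _.
  by rewrite mulr1 -EFinM.
by rewrite mulr0 mul0e.
Qed.

Lemma independent_prod r :
  (\int[Q]_w (\prod_(j < r) f j (W j w))%:E = (\prod_(j < r) e j)%:E)%E.
Proof.
have := @independent_prefix r [::] (fun _ => setT) isT.
rewrite /cyl set_nil bigcap_set0 probability_setT mule1 => ->//.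
Qed.

End IndependentProducts.

Section IndependentPair.
Local Open Scope ereal_scope.
Context d d1 d2 (T : measurableType d) (T1 : measurableType d1)
  (T2 : measurableType d2) (R : realType) (Q : probability T R).
Variables (X : {RV Q >-> T1}) (Y : {RV Q >-> T2}).
Hypothesis XY_indep : forall A B, measurable A -> measurable B ->
  Q (X @^-1` A `&` Y @^-1` B) = Q (X @^-1` A) * Q (Y @^-1` B).

(** Two independent variables have a product law, and the integrals over a
    product can be iterated. *)
Lemma integral_independent_pair (h : T1 * T2 -> \bar R) :
  measurable_fun setT h -> (forall z, 0 <= h z) ->
  \int[Q]_w h (X w, Y w) = \int[Q]_w \int[distribution Q Y]_y h (X w, y).
Proof.
move=> mh h0; pose XY w := (X w, Y w).
have mXY : measurable_fun setT XY.
  by apply/measurable_fun_pairP; split; exact: measurable_funPT.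
pose XY_mfun := isMeasurableFun.Build _ _ _ _ XY mXY.
pose XYp : {mfun T >-> (T1 * T2)%type} := HB.pack XY XY_mfun.
transitivity (\int[distribution Q XYp]_z h z).
  by rewrite ge0_integral_distribution.
transitivity (\int[distribution Q X \x distribution Q Y]_z h z).
  apply: eq_measure_integral => A mA _; apply/esym.
  apply: (@product_measure_unique _ _ _ _ _ (distribution Q X) (distribution Q Y)
    (distribution Q XYp)) => //.
rewrite fubini_tonelli1// ge0_integral_distribution//.
- exact: measurable_fun_fubini_tonelli_F.
- by move=> x; apply: integral_ge0.
Qed.

End IndependentPair.

(** * Moments of the beta laws *)

Section BetaMoments.
Variable R : realType.
Implicit Types a b c x : R.
Notation mu := (@lebesgue_measure R).

Let v a b x : R := x `^ a * (1 - x) `^ b.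

Let dv a b x : 0 < x < 1 ->
  is_derive x (1 : R) (v a b) (a * v (a - 1) b x - b * v a (b - 1) x).
Proof.
move=> /andP[x0 x1]; have y0 : 0 < 1 - x by rewrite subr_gt0.
have d1 := is_derive1_powR a x0.
have d2 := @is_derive1_comp R (fun y : R => powR y b) (cst 1 - id) x _ _ (is_derive1_powR b y0)
  (is_deriveB (is_derive_cst (1 : R) x 1) (is_derive_id x (1 : R))).
apply: (is_derive_eq (is_deriveM d1 d2)).
by rewrite /v /GRing.scale /= !fctE; ring.
Qed.

Let v_ge0 a b x : 0 <= v a b x.
Proof. by rewrite mulr_ge0 ?powR_ge0. Qed.

Let mv a b : measurable_fun setT (v a b).
Proof.
apply: measurable_funM; first exact: measurable_powR.
apply: (@measurableT_comp _ _ _ _ _ _ (fun y : R => y `^ b) _ (fun x => 1 - x)).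
  exact: measurable_powR.
exact: measurable_funB.
Qed.

Let eps n : R := n.+3%:R^-1.

Let eps_gt0 n : 0 < eps n. Proof. by rewrite invr_gt0. Qed.

Let eps_lt n : eps n < 1 - eps n.
Proof.
rewrite ltrBrDr -mulr2n -mulr_natr mulrC ltr_pdivrMr// mul1r.
by rewrite ltr_nat.
Qed.

Let eps_cvg0 : eps n @[n --> \oo] --> 0.
Proof.
have := @cvg_harmonic R; rewrite -(cvg_shiftn 2) => h.
by apply: cvg_trans h; apply: near_eq_cvg; near=> n; rewrite /eps /= addn2.
Unshelve. all: by end_near. Qed.

Let F n : set R := `[eps n, 1 - eps n].

Let F_in01 n x : F n x -> 0 < x < 1.
Proof.
rewrite /F /= in_itv /= => /andP[h1 h2]; rewrite (lt_le_trans _ h1)//=.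
by rewrite (le_lt_trans h2)// gtrBl.
Qed.

Let F_nd : nondecreasing_seq F.
Proof.
move=> m n mn; apply/subsetPset => x; rewrite /F /= !in_itv /= => /andP[h1 h2].
have nm : eps n <= eps m by rewrite lef_pV2 ?posrE// ler_nat.
by rewrite (le_trans nm h1) (le_trans h2)// lerD2l lerN2.
Qed.

Let bigcup_F : \bigcup_n F n = `]0, 1[%classic.
Proof.
apply/seteqP; split => x /=.
  by move=> [n _ /F_in01]; rewrite in_itv.
rewrite in_itv /= => /andP[x0 x1].
have m0 : 0 < Num.min x (1 - x) by rewrite lt_min x0 subr_gt0.
have [n _ h] : \forall n \near \oo, eps n <= Num.min x (1 - x).
  move/cvgr0Pnorm_le : eps_cvg0 => /(_ _ m0); apply: filterS => n.
  exact/le_trans/ler_norm.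
exists n => //; have := h n (leqnn n); rewrite le_min => /andP[h1 h2].
by rewrite /F /= in_itv /= h1 lerBrDr -lerBrDl.
Qed.

Let cv n a b : {within F n, continuous (v a b)}.
Proof.
by apply: derivable_within_continuous => x /F_in01/(dv a b)[].
Qed.

Let iv n a b : mu.-integrable (F n) (EFin \o v a b).
Proof. by apply: continuous_compact_integrable => //; exact: segment_compact. Qed.

Let v_cvg0 a b : 0 < a -> 0 <= b -> v a b (eps n) @[n --> \oo] --> 0.
Proof.
move=> a0 b0; apply: (@squeeze_cvgr _ _ _ _ (cst 0) (fun n => eps n `^ a)).
- near=> n; rewrite v_ge0 /v -[leRHS]mulr1 ler_wpM2l ?powR_ge0//.
  have e1 : 0 < 1 - eps n by rewrite (lt_trans (eps_gt0 n)) ?eps_lt.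
  have e2 : 0 < 1 - eps n <= 1 by rewrite e1 gerBl ltW.
  by have := ger_powR e2 b0; rewrite powRr0.
- exact: cvg_cst.
- by have /cvg_at_rightP := powR_cvg0 a0; apply.
Unshelve. all: by end_near. Qed.

Let v_sym a b x : v a b (1 - x) = v b a x.
Proof. by rewrite /v subKr mulrC. Qed.

Let v_by_parts n a b : 0 < a -> 0 < b ->
  (a%:E * \int[mu]_(x in F n) (v (a - 1) b x)%:E =
   b%:E * \int[mu]_(x in F n) (v a (b - 1) x)%:E +
   (v b a (eps n) - v a b (eps n))%:E)%E.
Proof.
move=> a0 b0.
pose g x := a * v (a - 1) b x - b * v a (b - 1) x.
have mF : measurable (F n) by exact: measurable_itv.
have cg : {within F n, continuous g}.
  move=> x; apply: cvgB; apply: cvgMr; exact: cv.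
have E : (\int[mu]_(x in F n) (g x)%:E = (v b a (eps n) - v a b (eps n))%:E)%E.
  rewrite (continuous_FTC2 (F := v a b))//.
  - by rewrite v_sym EFinB.
  - split.
    + move=> x xe; have /F_in01/(dv a b)[]// : F n x.
      exact: subset_itv_oo_cc xe.
    + apply: cvg_at_right_filter; apply/differentiable_continuous/derivable1_diffP.
      by have /F_in01/(dv a b)[] : F n (eps n) by rewrite /F /= in_itv /= lexx ltW.
    + apply: cvg_at_left_filter; apply/differentiable_continuous/derivable1_diffP.
      by have /F_in01/(dv a b)[] : F n (1 - eps n) by rewrite /F /= in_itv /= lexx ltW.
  - move=> x xe; rewrite derive1E; have /F_in01/(dv a b)[]// : F n x.
    exact: subset_itv_oo_cc xe.
have ig : mu.-integrable (F n) (EFin \o g).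
  by apply: continuous_compact_integrable => //; exact: segment_compact.
have i1 := iv n (a - 1) b; have i2 := iv n a (b - 1).
rewrite -E -(integralZl _ i1 a)// -(integralZl _ i2 b)//.
rewrite -(integralD _ (integrableZl _ b i2) ig)//.
by apply: eq_integral => x _; rewrite -EFinM -EFinD; congr (_%:E); rewrite /g; ring.
Qed.

(** Integration by parts on a segment [eps, 1 - eps], as the integrands may
    be unbounded at both ends. *)
Lemma beta_by_parts a b : 0 < a -> 0 < b ->
  (a%:E * \int[mu]_(x in `]0%R, 1%R[) (real_beta_weight a (b + 1) x)%:E =
   b%:E * \int[mu]_(x in `]0%R, 1%R[) (real_beta_weight (a + 1) b x)%:E)%E.
Proof.
move=> a0 b0.
have cF c e : (\int[mu]_(x in F n) (v c e x)%:E @[n --> \oo] -->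
    \int[mu]_(x in `]0%R, 1%R[) (v c e x)%:E)%E.
  rewrite -bigcup_F; apply: ge0_nondecreasing_set_cvg_integral => //.
  - by move=> n; exact: measurable_itv.
  - move=> n; apply/measurable_EFinP. apply: measurable_funTS. exact: mv.
  - by move=> n x _; rewrite lee_fin.
rewrite /real_beta_weight !addrK -/(v _ _ _).
have L : (a%:E * \int[mu]_(x in F n) (v (a - 1) b x)%:E @[n --> \oo] -->
    a%:E * \int[mu]_(x in `]0%R, 1%R[) (v (a - 1) b x)%:E)%E.
  by apply: cvgeZl => //; exact: cF.
have r : (v b a (eps n) - v a b (eps n))%:E @[n --> \oo] --> (0 : \bar R)%E.
  apply: cvg_EFin; first by near=> n.
  by rewrite -(subr0 0); apply: cvgB; apply: v_cvg0 => //; exact: ltW.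
have M : (b%:E * \int[mu]_(x in F n) (v a (b - 1) x)%:E +
    (v b a (eps n) - v a b (eps n))%:E @[n --> \oo] -->
    b%:E * \int[mu]_(x in `]0%R, 1%R[) (v a (b - 1) x)%:E + 0)%E.
  apply: cvgeD; [|by apply: cvgeZl => //; exact: cF|exact: r].
  by rewrite fin_num_adde_defl.
move: L; under eq_fun do rewrite v_by_parts//.
by move=> /(cvg_unique (@ereal_hausdorff R)) /(_ M); rewrite adde0.
Unshelve. all: by end_near. Qed.

Lemma measurable_beta_weight a b : measurable_fun setT (real_beta_weight a b).
Proof. exact: mv. Qed.

Lemma real_beta_weight_ge0 a b x : 0 <= real_beta_weight a b x.
Proof. exact: v_ge0. Qed.

Lemma real_beta_weight_monomial a b j l x : 0 < x < 1 ->
  real_beta_weight a b x * (x ^+ j * (1 - x) ^+ l) =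
  real_beta_weight (a + j%:R) (b + l%:R) x.
Proof.
move=> /andP[x0 x1]; have y0 : 0 < 1 - x by rewrite subr_gt0.
have E c z k : 0 < z -> z `^ (c + k%:R - 1) = z `^ (c - 1) * z ^+ k.
  move=> z0; have -> : c + k%:R - 1 = c - 1 + k%:R by ring.
  rewrite (@powRD _ z (c - 1) k%:R); last by rewrite (gt_eqF z0) implybT.
  by rewrite powR_mulrn// ltW.
rewrite /real_beta_weight !E//; ring.
Qed.

End BetaMoments.

(** Equal to the identity almost surely for a beta variable; it makes the
    moments below integrals of functions bounded everywhere. *)
Definition clamp (R : realType) (x : R) : R := Num.max 0 (Num.min 1 x).

Section Clamp.
Variable R : realType.
Implicit Types x : R.

Lemma clamp_in01 x : 0 <= clamp x <= 1.
Proof. by rewrite /clamp le_max lexx ge_max ler01 ge_min lexx. Qed.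

Lemma clamp_id x : 0 <= x <= 1 -> clamp x = x.
Proof. by move=> /andP[x0 x1]; rewrite /clamp min_r// max_r. Qed.

Lemma measurable_clamp : measurable_fun setT (@clamp R).
Proof. by apply: measurable_maxr => //; exact: measurable_minr. Qed.

Lemma clamp_monomial_ge0 j l x : 0 <= clamp x ^+ j * (1 - clamp x) ^+ l.
Proof.
by have /andP[h0 h1] := clamp_in01 x; rewrite mulr_ge0 ?exprn_ge0 ?subr_ge0.
Qed.

Lemma clamp_monomial_le1 j l x : clamp x ^+ j * (1 - clamp x) ^+ l <= 1.
Proof.
have /andP[h0 h1] := clamp_in01 x.
by rewrite mulr_ile1 ?exprn_ge0 ?exprn_ile1 ?subr_ge0// gerBl.
Qed.

Lemma measurable_clamp_monomial j l :
  measurable_fun setT (fun x => clamp x ^+ j * (1 - clamp x) ^+ l).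
Proof.
apply: measurable_funM; apply: measurable_funX; first exact: measurable_clamp.
by apply: measurable_funB => //; exact: measurable_clamp.
Qed.

End Clamp.

Section BetaDistributed.
Context d (T : measurableType d) (R : realType) (Q : probability T R).
Variables (W : {RV Q >-> R}) (a b : R).
Hypotheses (a0 : 0 < a) (b0 : 0 < b) (W_beta : beta_distributed W a b).
Notation mu := (@lebesgue_measure R).

Lemma beta_in01 : {ae Q, forall w, 0 < W w < 1}.
Proof.
exists (W @^-1` ~` `]0, 1[); split.
- rewrite -[X in measurable X]setTI; apply: measurable_funPT => //.
  exact: measurableC.
- transitivity (distribution Q W (~` `]0, 1[)) => //.
  rewrite W_beta; last exact: measurableC.
  by rewrite setICl integral_set0.
- by move=> w /= /negP; rewrite in_itv /= => /negP.
Qed.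

Let beta_fun_ge0 : 0 <= real_beta_fun a b.
Proof.
by apply: fine_ge0; apply: integral_ge0 => x _; rewrite lee_fin real_beta_weight_ge0.
Qed.

Definition beta_moment j l : \bar R :=
  (\int[Q]_w (clamp (W w) ^+ j * (1 - clamp (W w)) ^+ l)%:E)%E.

Lemma beta_momentE j l : (beta_moment j l = (real_beta_fun a b)^-1%:E *
  \int[mu]_(x in `]0%R, 1%R[) (real_beta_weight (a + j%:R) (b + l%:R) x)%:E)%E.
Proof.
pose f x : R := clamp x ^+ j * (1 - clamp x) ^+ l.
pose w1 x := real_beta_weight a b x / real_beta_fun a b * \1_(`]0, 1[%classic : set R) x.
have mw1 : measurable_fun setT w1.
  apply: measurable_funM; last exact: measurable_indic.
  by apply: measurable_funM => //; exact: measurable_beta_weight.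
have w10 x : 0 <= w1 x by rewrite mulr_ge0// divr_ge0 ?real_beta_weight_ge0.
have lawE A : measurable A ->
    distribution Q W A = (\int[mu]_(x in id @^-1` A) (w1 x)%:E)%E.
  move=> mA; rewrite W_beta// integral_mkcondr; apply: eq_integral => x _.
  by rewrite patchE /w1 indicE; case: ifPn => _; rewrite ?mulr1 ?mulr0.
have mf : measurable_fun setT (EFin \o f).
  by apply/measurable_EFinP; exact: measurable_clamp_monomial.
have f0 x : (0 <= (EFin \o f) x)%E by rewrite lee_fin clamp_monomial_ge0.
have := @integral_weighted _ _ _ _ R mu (distribution Q W) id w1
  (@measurable_id _ _ _) mw1 w10 lawE (EFin \o f) mf f0.
rewrite ge0_integral_distribution// => H.
transitivity (\int[mu]_x ((w1 x)%:E * (EFin \o f) x))%E; first exact: H.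
rewrite -ge0_integralZl//; last 3 first.
- by apply/measurable_EFinP/measurable_funTS; exact: measurable_beta_weight.
- by move=> x _; rewrite lee_fin real_beta_weight_ge0.
- by rewrite lee_fin invr_ge0.
rewrite [RHS]integral_mkcond; apply: eq_integral => x _.
rewrite patchE /w1 indicE; case: ifPn => [|_]; last by rewrite mulr0 mul0e.
rewrite inE /= in_itv /= => x01; rewrite mulr1 -!EFinM; congr (_%:E).
rewrite -(real_beta_weight_monomial a b j l x01) /f clamp_id; first by ring.
by case/andP: x01 => /ltW -> /ltW.
Qed.

Lemma measurable_clamp_monomial_comp j l :
  measurable_fun setT (fun w => clamp (W w) ^+ j * (1 - clamp (W w)) ^+ l).
Proof.
apply: (@measurableT_comp _ _ _ _ _ _
  (fun x : R => clamp x ^+ j * (1 - clamp x) ^+ l) _ W) => //.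
exact: measurable_clamp_monomial.
Qed.

Lemma beta_moment_fin j l : beta_moment j l \is a fin_num.
Proof.
rewrite ge0_fin_numE; last first.
  by apply: integral_ge0 => w _; rewrite lee_fin clamp_monomial_ge0.
apply: (@le_lt_trans _ _ (\int[Q]_w (cst 1 w))%E); last first.
  by rewrite integral_cst// mul1e (le_lt_trans (probability_le1 Q _)) ?ltry.
apply: ge0_le_integral => //.
- by move=> w _; rewrite lee_fin clamp_monomial_ge0.
- apply/measurable_EFinP; exact: measurable_clamp_monomial_comp.
- by move=> w _; rewrite lee_fin clamp_monomial_le1.
Qed.

(** The moments are determined by the total mass one, by W + (1 - W) = 1 and by
    the integration by parts. *)
Lemma beta_moment_val j l : beta_moment j l =
  (rising a j * rising b l / rising (a + b) (j + l))%:E.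
Proof.
pose e j l := fine (beta_moment j l).
have eE i k : beta_moment i k = (e i k)%:E by rewrite fineK// beta_moment_fin.
have split i k : e i k = e i.+1 k + e i k.+1.
  apply/EFin_inj; rewrite EFinD -!eE /beta_moment -ge0_integralD//.
  - apply: eq_integral => w _; rewrite -EFinD; congr (_%:E).
    by rewrite !exprS; ring.
  - by move=> w _; rewrite lee_fin clamp_monomial_ge0.
  - apply/measurable_EFinP; exact: measurable_clamp_monomial_comp.
  - by move=> w _; rewrite lee_fin clamp_monomial_ge0.
  - apply/measurable_EFinP; exact: measurable_clamp_monomial_comp.
have parts i k : (a + i%:R) * e i k.+1 = (b + k%:R) * e i.+1 k.
  apply/EFin_inj; rewrite 2!EFinM -!eE !beta_momentE.
  rewrite muleCA [RHS]muleCA -!natr1 !addrA beta_by_parts//; exact: ltr_wpDr.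
have e00 : e 0 0 = 1.
  apply/EFin_inj; rewrite -eE /beta_moment.
  under eq_integral do rewrite !expr0 mulr1.
  by rewrite integral_cst// mul1e; exact: probability_setT.
have ab n : 0 < a + b + n%:R by rewrite ltr_wpDr ?addr_gt0.
have step1 i k : e i.+1 k = (a + i%:R) / (a + b + (i + k)%:R) * e i k.
  apply: (mulfI (lt0r_neq0 (ab (i + k)%N))); rewrite mulrA mulrCA divff ?gt_eqF// mulr1.
  by rewrite [e i k]split mulrDr parts natrD; ring.
have step2 k : e 0 k.+1 = (b + k%:R) / (a + b + k%:R) * e 0 k.
  apply: (mulfI (lt0r_neq0 (ab k))); rewrite mulrA mulrCA divff ?gt_eqF// mulr1.
  have := parts 0 k; rewrite addr0 => p.
  by rewrite [e 0 k in RHS]split mulrDr -p; ring.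
rewrite eE; congr (_%:E); elim: j => [|j ih].
  elim: l => [|l ih]; first by rewrite e00 !rising0 mulr1 divr1.
  by rewrite step2 ih add0n !risingSr rising0 invfM; ring.
by rewrite step1 ih addSn !risingSr invfM; ring.
Qed.

End BetaDistributed.

(** * Power sums of a sequence of mass one *)

Section PowerSums.
Variable R : realType.
Implicit Types (s t : nat -> R) (p : seq nat).

Definition partial_psum s N m : R := \sum_(i < N) s i ^+ m.

(** The absolute values give measurability on the whole sequence space. *)
Definition psum s m : R := fine (\sum_(0 <= i <oo) (`|s i| ^+ m)%:E)%E.

Definition mass_one s := (forall i, 0 <= s i) /\
  (\sum_(0 <= i <oo) (s i)%:E = 1)%E.

(** The probability that individuals grouped in blocks of sizes p fall in the
    same interval within each block, and in different ones across blocks. *)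
Definition dsum s p := distinct_sum (psum s) p.

Lemma Sdown_mass_one s : Sdown s -> mass_one s.
Proof. by move=> [h ?]; split => // i; have /andP[h1 /(le_trans h1)] := h i. Qed.

(** Atoms are added one at a time, and each addition only adds nonnegative
    terms. *)
Lemma partial_dsum_ge0 s N p : (forall i, 0 <= s i) ->
  0 <= distinct_sum (partial_psum s N) p.
Proof.
move=> s0; elim: N p => [|N ih] p.
  rewrite (_ : partial_psum s 0 = fun=> 0) ?distinct_sum0 ?ler0n//.
  by apply/funext => m; rewrite /partial_psum big_ord0.
rewrite (_ : partial_psum s N.+1 = fun m => partial_psum s N m + s N ^+ m); last first.
  by apply/funext => m; rewrite /partial_psum big_ord_recr.
rewrite distinct_sum_add_atom addr_ge0// sumr_ge0// => d _.
by rewrite mulr_ge0// exprn_ge0.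
Qed.

Lemma distinct_sum_cvg (u : nat -> nat -> R) (P : nat -> R) p :
  (forall m, (0 < m)%N -> u n m @[n --> \oo] --> P m) -> all (leq 1) p ->
  distinct_sum (u n) p @[n --> \oo] --> distinct_sum P p.
Proof.
move=> uP; elim/size_ind: p => [_|m p ih /andP[m0 p1]]; first exact: cvg_cst.
rewrite distinct_sum_cons; under eq_fun do rewrite distinct_sum_cons.
apply: cvgB; first by apply: cvgM; [exact: uP|exact: ih].
have : forall q, q \in bumps m p ->
    distinct_sum (u n) q @[n --> \oo] --> distinct_sum P q.
  by move=> q qb; apply: ih; [exact: size_bumps qb|exact: all_bumps p1 qb].
elim: (bumps m p) => [|q l ihl] ql.
  by rewrite big_nil; under eq_fun do rewrite big_nil; exact: cvg_cst.
rewrite big_cons; under eq_fun do rewrite big_cons.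
apply: cvgD; first by apply: ql; rewrite mem_head.
by apply: ihl => r rl; apply: ql; rewrite inE rl orbT.
Qed.

Section mass_one.
Variable s : nat -> R.
Hypothesis s_mass : mass_one s.

Lemma mass_one_le1 i : s i <= 1.
Proof.
have [s0 s1] := s_mass; rewrite -lee_fin -s1.
apply: (@le_trans _ _ (\sum_(0 <= j < i.+1) (s j)%:E)%E).
  by rewrite big_nat_recr//= leeDr// sume_ge0// => j _; rewrite lee_fin.
by apply: nneseries_lim_ge => j _ _; rewrite lee_fin.
Qed.

Lemma psum_fin m : (0 < m)%N ->
  (\sum_(0 <= i <oo) (s i ^+ m)%:E = (psum s m)%:E)%E.
Proof.
have [s0 s1] := s_mass; move=> m0; rewrite /psum.
have E : (\sum_(0 <= i <oo) (s i ^+ m)%:E = \sum_(0 <= i <oo) (`|s i| ^+ m)%:E)%E.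
  by apply: eq_eseriesr => i _; rewrite ger0_norm.
rewrite -E fineK// ge0_fin_numE; last by apply: nneseries_ge0 => i _ _; rewrite lee_fin exprn_ge0.
apply: (@le_lt_trans _ _ 1%E); last by rewrite ltry.
rewrite -s1; apply: lee_nneseries => [i _ _|i _]; first by rewrite lee_fin exprn_ge0.
by rewrite lee_fin -{2}[s i]expr1 ler_wiXn2l// mass_one_le1.
Qed.

Lemma psum1 : psum s 1 = 1.
Proof.
by have [s0 s1] := s_mass; apply/EFin_inj; rewrite -psum_fin// -[RHS]s1.
Qed.

Lemma partial_psum_cvg m : (0 < m)%N ->
  partial_psum s N m @[N --> \oo] --> psum s m.
Proof.
have [s0 s1] := s_mass; move=> m0.
have : (\sum_(0 <= i < N) (s i ^+ m)%:E @[N --> \oo] -->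
    \sum_(0 <= i <oo) (s i ^+ m)%:E)%E.
  by apply: is_cvg_nneseries => i _ _; rewrite lee_fin exprn_ge0.
rewrite psum_fin// => /fine_cvgP[_]; apply: cvg_trans; apply: near_eq_cvg.
by near=> N; rewrite /= sumEFin /= big_mkord.
Unshelve. all: by end_near. Qed.

Lemma dsum_cvg p : all (leq 1) p ->
  distinct_sum (partial_psum s N) p @[N --> \oo] --> dsum s p.
Proof. by move=> p1; apply: distinct_sum_cvg => // m; exact: partial_psum_cvg. Qed.

Lemma dsum_ge0 p : all (leq 1) p -> 0 <= dsum s p.
Proof.
move=> p1; have h := dsum_cvg p1; rewrite -(cvg_lim (@norm_hausdorff _ _) h)//.
apply: limr_ge; first by apply/cvg_ex; eexists; exact: h.
by near=> N; apply: partial_dsum_ge0; case: s_mass.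
Unshelve. all: by end_near. Qed.

(** One more individual joins one of the blocks or starts a new one. *)
Lemma dsum_consistent p :
  dsum s p = dsum s (1%N :: p) + \sum_(q <- bumps 1 p) dsum s q.
Proof. by rewrite -distinct_sum_split psum1 mul1r. Qed.

(** Only the power sums enter, and they ignore the order of the terms. *)
Lemma psum_rearrangement t (sigma : nat -> nat) m : bijective sigma ->
  (forall i, s i = t (sigma i)) -> psum s m = psum t m.
Proof.
move=> bs st; rewrite /psum !nneseries_esumT//.
rewrite (@reindex_esum _ _ _ setT setT sigma (fun i => (`|t i| ^+ m)%:E)).
  by congr fine; apply: eq_esum => i _; rewrite st.
by rewrite setTT_bijective.
Qed.

Lemma mass_one_rearrangement t (sigma : nat -> nat) : bijective sigma ->
  (forall i, s i = t (sigma i)) -> mass_one t.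
Proof.
move=> [tau st ts] E; have [s0 s1] := s_mass.
have t0 i : 0 <= t i by rewrite -(ts i) -E.
split=> //; rewrite -[RHS]s1 !nneseries_esumT; try by move=> i; rewrite lee_fin.
rewrite (@reindex_esum _ _ _ setT setT sigma (fun i => (t i)%:E)).
  by apply: eq_esum => i _; rewrite E.
by rewrite setTT_bijective; exists tau.
Qed.

End mass_one.

Section Measurability.

Lemma measurable_coord i : measurable_fun setT (fun s : seqspace R => s i).
Proof.
move=> _ B mB; apply: sub_sigma_algebra; exists i => //=; exists B => //.
Qed.

Lemma measurable_psum m : measurable_fun setT (fun s : seqspace R => psum s m).
Proof.
rewrite /psum; apply: (measurableT_comp (fine_measurable measurableT)).
apply: ge0_emeasurable_sum => [i s _ _|i _]; first by rewrite lee_fin exprn_ge0.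
apply/measurable_EFinP; apply: measurable_funX.
by apply: measurableT_comp => //; exact: measurable_coord.
Qed.

Lemma measurable_distinct_sum d (T : measurableType d) (P : T -> nat -> R) p :
  (forall m, measurable_fun setT (fun x => P x m)) ->
  measurable_fun setT (fun x => distinct_sum (P x) p).
Proof.
move=> mP; elim/size_ind: p => [|m p ih]; first exact: measurable_cst.
under eq_fun do rewrite distinct_sum_cons.
apply: measurable_funB; first by apply: measurable_funM => //; exact: ih.
have : forall q, q \in bumps m p -> measurable_fun setT (fun x => distinct_sum (P x) q).
  by move=> q qb; apply: ih; exact: size_bumps qb.
elim: (bumps m p) => [|q l ihl] ql.
  by under eq_fun do rewrite big_nil; exact: measurable_cst.
under eq_fun do rewrite big_cons.
apply: measurable_funD; first by apply: ql; rewrite mem_head.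
by apply: ihl => r rl; apply: ql; rewrite inE rl orbT.
Qed.

Lemma measurable_dsum p : measurable_fun setT (fun s : seqspace R => dsum s p).
Proof. by apply: measurable_distinct_sum => m; exact: measurable_psum. Qed.

Lemma measurable_Sdown : measurable (@Sdown R : set (seqspace R)).
Proof.
pose A : set (seqspace R) := \bigcap_i [set s : seqspace R | 0 <= s i.+1] `&`
  \bigcap_i [set s : seqspace R | s i.+1 <= s i].
pose B : set (seqspace R) :=
  [set s : seqspace R | (\sum_(0 <= i <oo) (`|s i|)%:E = 1)%E].
have -> : (@Sdown R : set (seqspace R)) = A `&` B.
  apply/seteqP; split => s /=.
    move=> sd; have [s0 s1] := Sdown_mass_one sd; case: sd => h _.
    split; first by split => i _ /=; have /andP[] := h i.
    by rewrite /B /= -[RHS]s1; apply: eq_eseriesr => i _; rewrite ger0_norm.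
  move=> [[h1 h2] h3]; split => [i|]; first by rewrite (h1 i I) (h2 i I).
  rewrite -[RHS]h3; apply: eq_eseriesr => i _; rewrite ger0_norm//.
  by have := h1 i I; have := h2 i I => /= h4 h5; exact: le_trans h4.
apply: measurableI.
  apply: measurableI; apply: bigcap_measurable => // i _.
  - rewrite -[X in measurable X]setTI; apply: measurable_fun_le => //.
    exact: measurable_coord.
  - rewrite -[X in measurable X]setTI; apply: measurable_fun_le => //;
    exact: measurable_coord.
rewrite /B -[X in measurable X]setTI; apply: emeasurable_fun_eq => //.
apply: ge0_emeasurable_sum => [i s _ _|i _]; first by rewrite lee_fin.
apply/measurable_EFinP.
by apply: measurableT_comp => //; exact: measurable_coord.
Qed.

End Measurability.

End PowerSums.

(** * Stick-breaking *)

Section StickBreakingRecursion.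
Variable R : realType.
Implicit Types (u : nat -> R) (p : seq nat).

Lemma stick_breakingS u j :
  stick_breaking u j.+1 = (1 - u 0) * stick_breaking (fun i => u i.+1) j.
Proof. by rewrite /stick_breaking big_ord_recl; ring. Qed.

Lemma partial_psum_stick u N m : partial_psum (stick_breaking u) N.+1 m =
  (1 - u 0) ^+ m * partial_psum (stick_breaking (fun i => u i.+1)) N m + u 0 ^+ m.
Proof.
rewrite /partial_psum big_ord_recl addrC; congr (_ + _ ^+ m).
  rewrite mulr_sumr; apply: eq_bigr => i _.
  by rewrite lift0 stick_breakingS exprMn.
by rewrite /stick_breaking big_ord0 mulr1.
Qed.

(** The first stick is an added atom, the other ones are scaled by 1 - u 0. *)
Lemma partial_dsum_stick u N p :
  let D q := distinct_sum (partial_psum (stick_breaking (fun i => u i.+1)) N) q in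
  distinct_sum (partial_psum (stick_breaking u) N.+1) p =
  (1 - u 0) ^+ sumn p * D p +
  \sum_(d <- deletions p) u 0 ^+ d.1 * ((1 - u 0) ^+ sumn d.2 * D d.2).
Proof.
rewrite /= (_ : partial_psum (stick_breaking u) N.+1 = fun m => (1 - u 0) ^+ m *
    partial_psum (stick_breaking (fun i => u i.+1)) N m + u 0 ^+ m); last first.
  by apply/funext => m; rewrite partial_psum_stick.
rewrite distinct_sum_add_atom distinct_sum_scale; congr (_ + _).
by apply: eq_bigr => d _; rewrite distinct_sum_scale.
Qed.

Lemma stick_breaking_ge0 u : (forall i, 0 <= u i <= 1) ->
  forall j, 0 <= stick_breaking u j.
Proof.
move=> u01 j; rewrite mulr_ge0//; first by case/andP: (u01 j).
by apply: prodr_ge0 => i _; rewrite subr_ge0; case/andP: (u01 i).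
Qed.

End StickBreakingRecursion.

Section StickBreakingMoments.
Context d (T : measurableType d) (R : realType) (Q : probability T R).
Variables (alpha theta : R) (W : nat -> {RV Q >-> R}).
Hypotheses (alpha_ge0 : 0 <= alpha) (alpha_lt1 : alpha < 1).
Hypothesis theta_gt : - alpha < theta.
Hypothesis W_indep : mutually_independent W.
Hypothesis W_beta : forall j,
  beta_distributed (W j) (1 - alpha) (theta + alpha * j.+1%:R).

Let cW w j : R := clamp (W j w).

Let cW01 w j : 0 <= cW w j <= 1. Proof. exact: clamp_in01. Qed.

Let e j a b : R := rising (1 - alpha) a * rising (theta + alpha * j.+1%:R) b /
  rising (1 - alpha + (theta + alpha * j.+1%:R)) (a + b).

Let prefix r (A B : nat -> nat) w : R :=
  \prod_(j < r) (cW w j ^+ A j * (1 - cW w j) ^+ B j).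

Let prefix_ge0 r A B w : 0 <= prefix r A B w.
Proof. by apply: prodr_ge0 => j _; exact: clamp_monomial_ge0. Qed.

Let b_gt0 j : 0 < theta + alpha * j.+1%:R.
Proof. by rewrite mulrC; exact: weight_gt0. Qed.

Let prefixE r A B :
  (\int[Q]_w (prefix r A B w)%:E = (\prod_(j < r) e j (A j) (B j))%:E)%E.
Proof.
apply: (@independent_prod _ _ _ Q W
  (fun j x => clamp x ^+ A j * (1 - clamp x) ^+ B j)
  (fun j => e j (A j) (B j)) W_indep).
- by move=> j; exact: measurable_clamp_monomial.
- by move=> j x; exact: clamp_monomial_ge0.
- move=> j; have a0 : 0 < 1 - alpha by rewrite subr_gt0.
  exact: (beta_moment_val a0 (b_gt0 j) (W_beta j)).
Qed.

Let D N r p w : R :=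
  distinct_sum (partial_psum (stick_breaking (fun j => cW w (r + j))) N) p.

Let D_ge0 N r p w : 0 <= D N r p w.
Proof. by apply: partial_dsum_ge0; exact: stick_breaking_ge0. Qed.

Let mcW j : measurable_fun setT (cW ^~ j).
Proof. by apply: measurableT_comp; [exact: measurable_clamp|]. Qed.

Let mD N r p : measurable_fun setT (D N r p).
Proof.
apply: measurable_distinct_sum => m; apply: measurable_sum => i.
apply: measurable_funX; apply: measurable_funM; first exact: mcW.
by apply: measurable_prod => j _; apply: measurable_funB => //; exact: mcW.
Qed.

Let mprefix r A B : measurable_fun setT (prefix r A B).
Proof.
apply: measurable_prod => j _.
apply: measurable_funM; apply: measurable_funX; first exact: mcW.
by apply: measurable_funB => //; exact: mcW.
Qed.

Let upd (A : nat -> nat) r a j := if j == r then a else A j.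

Let prod_upd r A B a b (f : nat -> nat -> nat -> R) :
  \prod_(j < r.+1) f j (upd A r a j) (upd B r b j) =
  \prod_(j < r) f j (A j) (B j) * f r a b.
Proof.
rewrite big_ord_recr /= /upd eqxx; congr (_ * _); apply: eq_bigr => j _.
by rewrite ltn_eqF.
Qed.

(** An upper bound, because truncation to N sticks loses mass.  The moments of
    the sticks already broken are carried along, so that only products of powers
    of independent variables have to be integrated. *)
Lemma stick_dsum_prefix_le N r A B p : all (leq 1) p ->
  (\int[Q]_w (prefix r A B w * D N r p w)%:E <=
   (\prod_(j < r) e j (A j) (B j) * eppf alpha (theta + r%:R * alpha) p)%:E)%E.
Proof.
have th_gt k : - alpha < theta + k%:R * alpha.
  by rewrite (lt_le_trans theta_gt)// lerDl mulr_ge0.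
have e_ge0 j a b : 0 <= e j a b.
  rewrite !mulr_ge0 ?invr_ge0//; apply/ltW/rising_gt0; rewrite ?subr_gt0//.
  by rewrite addr_gt0// subr_gt0.
elim: N r A B p => [|N ih] r A B p p1.
  rewrite (_ : D 0 r p = fun=> (p == [::])%:R); last first.
    apply/funext => w; rewrite /D (_ : partial_psum _ 0 = fun=> 0) ?distinct_sum0//.
    by apply/funext => m; rewrite /partial_psum big_ord0.
  under eq_integral do rewrite EFinM.
  rewrite ge0_integralZr//=; last 2 first.
  - by apply/measurable_EFinP; exact: mprefix.
  - by move=> w _; rewrite lee_fin prefix_ge0.
  rewrite prefixE -EFinM lee_fin ler_wpM2l ?prodr_ge0//.
  case: eqP => [->|_]; first by rewrite eppf_nil.
  by apply/ltW/eppf_gt0.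
have [->|pn] := eqVneq p [::].
  under eq_integral do rewrite /D distinct_sum_nil mulr1.
  by rewrite prefixE eppf_nil mulr1.
have DE w : prefix r A B w * D N.+1 r p w =
    prefix r.+1 (upd A r 0) (upd B r (sumn p)) w * D N r.+1 p w +
    \sum_(x <- deletions p)
      prefix r.+1 (upd A r x.1) (upd B r (sumn x.2)) w * D N r.+1 x.2 w.
  rewrite /D partial_dsum_stick addn0 /= mulrDr mulr_sumr.
  rewrite (_ : (fun i => cW w (r + i.+1)) = (fun i => cW w (r.+1 + i))); last first.
    by apply/funext => i; rewrite addnS.
  rewrite /prefix (prod_upd r A B _ _ (fun j a b => cW w j ^+ a * (1 - cW w j) ^+ b)).
  rewrite expr0 mul1r mulrA; congr (_ + _); apply: eq_bigr => x _.
  rewrite (prod_upd r A B _ _ (fun j a b => cW w j ^+ a * (1 - cW w j) ^+ b)); ring.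
have mt A' B' q : measurable_fun setT
    (fun w => (prefix r.+1 A' B' w * D N r.+1 q w)%:E).
  by apply/measurable_EFinP; apply: measurable_funM; [exact: mprefix|exact: mD].
have t0 A' B' q w : (0 <= (prefix r.+1 A' B' w * D N r.+1 q w)%:E)%E.
  by rewrite lee_fin mulr_ge0.
under eq_integral do rewrite DE EFinD -sumEFin.
rewrite ge0_integralD//; last 2 first.
- by move=> w _; apply: sume_ge0 => x _; exact: t0.
- by apply: emeasurable_sum => x; exact: mt.
rewrite ge0_integral_sum//.
rewrite eppf_recursion// mulrDr mulr_sumr EFinD -sumEFin.
have th1 : theta + r%:R * alpha + alpha = theta + r.+1%:R * alpha.
  by rewrite -natr1; ring.
have eE a b : rising (1 - alpha) a * rising (theta + r%:R * alpha + alpha) b /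
    rising (theta + r%:R * alpha + 1) (a + b) = e r a b.
  rewrite /e th1 [r.+1%:R * alpha]mulrC; congr (_ / rising _ _).
  by rewrite -natr1; ring.
have ihr a b q : all (leq 1) q ->
    (\int[Q]_w (prefix r.+1 (upd A r a) (upd B r b) w * D N r.+1 q w)%:E <=
     (\prod_(j < r) e j (A j) (B j) *
       (e r a b * eppf alpha (theta + r%:R * alpha + alpha) q))%:E)%E.
  move=> q1; apply: le_trans (ih _ _ _ _ q1) _.
  by rewrite (prod_upd r A B _ _ e) th1 mulrA.
rewrite eE leeD//; first exact: ihr.
rewrite big_seq [leRHS]big_seq; apply: lee_sum => x xp; rewrite eE; apply: ihr.
by have [_ _ s3] := deletionsP xp; move: p1; rewrite s3 => /andP[].
Qed.

Variable V : {RV Q >-> seqspace R}.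
Hypothesis V_rearr : {ae Q, forall w,
  decreasing_rearrangement (stick_breaking (fun j => W j w)) (V w)}.
Hypothesis V_Sdown : {ae Q, forall w, Sdown (V w)}.

Lemma W_in01 : {ae Q, forall w j, cW w j = W j w}.
Proof.
have a0 : 0 < 1 - alpha by rewrite subr_gt0.
apply/ae_foralln => j; apply: filterS (beta_in01 (W_beta j)) => w /andP[h0 h1].
by rewrite /cW clamp_id// !ltW.
Qed.

(** Fatou's lemma passes from finitely many sticks to all of them. *)
Lemma ranked_dsum_le p : all (leq 1) p ->
  (\int[Q]_w (`|dsum (V w) p|)%:E <= (eppf alpha theta p)%:E)%E.
Proof.
move=> p1.
have mV : measurable_fun setT (fun w => (`|dsum (V w) p|)%:E).
  apply/measurable_EFinP; apply: measurableT_comp => //.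
  by apply: (@measurableT_comp _ _ _ _ _ _ (fun s : seqspace R => dsum s p) _ V) => //;
    exact: measurable_dsum.
have mDE N : measurable_fun setT (EFin \o D N 0 p) by exact/measurable_EFinP.
have le N : (\int[Q]_w (D N 0 p w)%:E <= (eppf alpha theta p)%:E)%E.
  have := @stick_dsum_prefix_le N 0 (fun=> 0%N) (fun=> 0%N) p p1.
  rewrite big_ord0 mul1r mul0r addr0; apply: le_trans.
  rewrite le_eqVlt; apply/orP; left; apply/eqP; apply: eq_integral => w _.
  by rewrite /prefix big_ord0 mul1r.
have lim : {ae Q, forall w, setT w ->
    (`|dsum (V w) p|)%:E = limn_einf (fun N => (D N 0 p w)%:E)}.
  apply: filterS3 W_in01 V_rearr V_Sdown => w cWw [_ [sigma bs Vs]] /Sdown_mass_one sd _.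
  have tm := mass_one_rearrangement sd bs Vs.
  have E : (fun j => cW w (0 + j)) = (fun j => W j w) by apply/funext => j; rewrite cWw.
  have c : distinct_sum (partial_psum (stick_breaking (fun j => W j w)) N) p
      @[N --> \oo] --> dsum (V w) p.
    rewrite (_ : dsum (V w) p = dsum (stick_breaking (fun j => W j w)) p).
      exact: dsum_cvg.
    by apply: eq_distinct_sum => // m _; exact: psum_rearrangement bs Vs.
  rewrite ger0_norm ?dsum_ge0// is_cvg_limn_einfE.
    rewrite -(cvg_lim (@norm_hausdorff _ _) c) -EFin_lim; last by apply/cvg_ex; eexists; exact: c.
    by rewrite /D E.
  apply/cvg_ex; exists (dsum (V w) p)%:E; rewrite /D E.
  by apply: cvg_EFin; [near=> N|exact: c].
rewrite (ge0_ae_eq_integral measurableT mV _ _ _ lim)//; last 2 first.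
- apply: (measurableT_comp (@oppe_measurable _ setT)).
  apply: (measurable_fun_limn_esup (f := fun N w => (- (D N 0 p w)%:E)%E)) => N.
  exact: (measurableT_comp (@oppe_measurable _ setT) (mDE N)).
- move=> w _; rewrite limn_einf_lim; apply: lime_ge; first exact: is_cvg_einfs.
  by near=> n; apply: le_ereal_inf_tmp => _ [m _ <-]; rewrite lee_fin.
apply: le_trans; first by apply: fatou => // N w _; rewrite lee_fin.
rewrite limn_einf_lim; apply: lime_le; first exact: is_cvg_einfs.
near=> N; apply: le_trans (le N); apply: ereal_inf_lbound.
by exists N => //=.
Unshelve. all: by end_near. Qed.

End StickBreakingMoments.

(** * Pitman's formula for the ranked frequencies *)

Section ExpectedDistinctSums.
Context d (Omega : measurableType d) (R : realType) (Pr : probability Omega R).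
Variables (alpha theta : R) (P : probability (seqspace R) R).
Variable S : {RV Pr >-> seqspace R}.
Hypotheses (alpha_ge0 : 0 <= alpha) (alpha_lt1 : alpha < 1).
Hypothesis theta_gt : - alpha < theta.
Hypothesis P_PDP : is_PDP alpha theta P.
Hypothesis S_Sdown : forall w, Sdown (S w).
Hypothesis S_law : forall A, measurable A -> distribution Pr S A = P A.

Let S_mass w : mass_one (S w).
Proof. exact: Sdown_mass_one. Qed.

Lemma measurable_dsum_comp p : measurable_fun setT (fun w => dsum (S w) p).
Proof.
by apply: (@measurableT_comp _ _ _ _ _ _ (fun s : seqspace R => dsum s p) _ S) => //;
  exact: measurable_dsum.
Qed.

(** [S] and the rearranged sticks have the same law. *)
Lemma expected_dsum_le p : all (leq 1) p ->
  (\int[Pr]_w (`|dsum (S w) p|)%:E <= (eppf alpha theta p)%:E)%E.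
Proof.
move=> p1; have [d' [T [Q [W [V [W_indep W_beta V_rearr V_law]]]]]] := P_PDP.
have lawE A : measurable A -> distribution Pr S A = distribution Q V A.
  by move=> mA; rewrite S_law// V_law.
have V_Sdown : {ae Q, forall w, Sdown (V w)}.
  have mC := measurableC (@measurable_Sdown R).
  exists (V @^-1` (~` (@Sdown R : set (seqspace R)))); split => //.
  - by rewrite -[X in measurable X]setTI; exact: measurable_funPT.
  - transitivity (distribution Q V (~` (@Sdown R : set (seqspace R)))) => //.
    rewrite -lawE// /distribution /pushforward.
    rewrite (_ : _ @^-1` _ = set0) ?measure0//.
    by apply/seteqP; split => // w /=; apply; exact: S_Sdown.
have mf : measurable_fun setT (fun s : seqspace R => (`|dsum s p|)%:E).
  apply/measurable_EFinP; apply: measurableT_comp => //; exact: measurable_dsum.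
apply: le_trans (ranked_dsum_le alpha_ge0 alpha_lt1 theta_gt W_indep W_beta
  V_rearr V_Sdown p1).
have E : (\int[Pr]_w (`|dsum (S w) p|)%:E = \int[Q]_w (`|dsum (V w) p|)%:E)%E.
  transitivity (\int[distribution Pr S]_s (`|dsum s p|)%:E)%E.
    by rewrite ge0_integral_distribution.
  transitivity (\int[distribution Q V]_s (`|dsum s p|)%:E)%E.
    by apply: eq_measure_integral => A mA _; exact: lawE.
  by rewrite ge0_integral_distribution.
by rewrite -E.
Qed.

(** Both sides of the bound above satisfy the consistency relation that comes
    from a total mass of one, and they agree on the empty vector: equality
    propagates from a vector to all its successors. *)
Lemma expected_dsum p : all (leq 1) p ->
  (\int[Pr]_w (dsum (S w) p)%:E = (eppf alpha theta p)%:E)%E.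
Proof.
pose I q := (\int[Pr]_w (`|dsum (S w) q|)%:E)%E.
have I_ge0 q : (0 <= I q)%E by apply: integral_ge0.
have mI q : measurable_fun setT (fun w => (`|dsum (S w) q|)%:E).
  apply/measurable_EFinP; apply: measurableT_comp => //.
  exact: measurable_dsum_comp.
pose i q := fine (I q).
have iE q : all (leq 1) q -> I q = (i q)%:E.
  move=> q1; rewrite fineK// ge0_fin_numE ?I_ge0//.
  by apply: le_lt_trans (expected_dsum_le q1) _; rewrite ltry.
have i_le q : all (leq 1) q -> i q <= eppf alpha theta q.
  by move=> q1; rewrite -lee_fin -iE//; exact: expected_dsum_le.
have consistent q : all (leq 1) q -> i q = i (1%N :: q) + \sum_(r <- bumps 1 q) i r.
  move=> q1; apply/EFin_inj; rewrite EFinD -sumEFin -!iE//.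
  rewrite (eq_big_seq (fun r => I r)); last by move=> r rq; rewrite iE// (all_bumps q1 rq).
  rewrite /I -ge0_integral_sum// -ge0_integralD//; last 2 first.
  - by move=> w _; apply: sume_ge0.
  - exact: emeasurable_sum.
  apply: eq_integral => w _; rewrite sumEFin -EFinD; congr (_%:E).
  rewrite !ger0_norm ?dsum_ge0// dsum_consistent//; congr (_ + _).
  by apply: eq_big_seq => r rq; rewrite ger0_norm// dsum_ge0// (all_bumps q1 rq).
have step q : all (leq 1) q -> i q = eppf alpha theta q ->
    i (1%N :: q) = eppf alpha theta (1%N :: q) /\
    (forall r, r \in bumps 1 q -> i r = eppf alpha theta r).
  move=> q1 iq; have := consistent q q1.
  rewrite iq -(eppf_consistent alpha_lt1 theta_gt q1) => /eqP.
  rewrite -subr_eq0 opprD addrACA -sumrB addr_eq0 => E.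
  have p1 : 0 <= eppf alpha theta (1%N :: q) - i (1%N :: q).
    by rewrite subr_ge0 i_le.
  have p2 r : r \in bumps 1 q -> 0 <= eppf alpha theta r - i r.
    by move=> rq; rewrite subr_ge0 i_le// (all_bumps q1 rq).
  have s0 : 0 <= \sum_(r <- bumps 1 q) (eppf alpha theta r - i r).
    by rewrite big_seq sumr_ge0// => r rq; exact: p2.
  have z1 : eppf alpha theta (1%N :: q) - i (1%N :: q) = 0.
    by apply/eqP; rewrite eq_le p1 andbT (eqP E) oppr_le0.
  have z2 : \sum_(r <- bumps 1 q) (eppf alpha theta r - i r) = 0.
    by apply/eqP; rewrite -oppr_eq0 -(eqP E) z1.
  split; first by apply/eqP; rewrite eq_sym -subr_eq0 z1.
  move=> r rq; apply/eqP; rewrite eq_sym -subr_eq0.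
  move/eqP : z2; rewrite big_seq psumr_eq0//.
  by move=> /allP /(_ r rq); rewrite rq.
move=> p1; transitivity (I p).
  by apply: eq_integral => w _; rewrite ger0_norm// dsum_ge0.
rewrite iE//; congr (_%:E).
elim: p p1 => [_|[//|m] p ih /= p1].
  rewrite eppf_nil; apply/EFin_inj; rewrite -iE// /I.
  under eq_integral do rewrite /dsum distinct_sum_nil normr1.
  by rewrite integral_cst// mul1e; exact: probability_setT.
elim: m => [|m ihm]; first by have [] := step p p1 (ih p1).
have [_ h] := step (m.+1 :: p) p1 ihm.
by apply: h; rewrite /= add1n mem_head.
Qed.

End ExpectedDistinctSums.

(** * Combinatorics of a sample *)

Section Species.
Variable T : eqType.
Implicit Types (i : seq T) (p : seq nat).

Definition species i : seq T := rev (undup (rev i)).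

Definition counts i : seq nat := [seq count_mem x i | x <- species i].

Lemma mem_species i : species i =i i.
Proof. by move=> x; rewrite mem_rev mem_undup mem_rev. Qed.

Lemma species_uniq i : uniq (species i).
Proof. by rewrite rev_uniq undup_uniq. Qed.

Lemma species_rcons i x :
  species (rcons i x) = if x \in i then species i else rcons (species i) x.
Proof.
by rewrite /species rev_rcons /= mem_rev; case: ifP => // _; rewrite rev_cons.
Qed.

Lemma species_block a x i : (0 < a)%N -> x \notin i ->
  species (nseq a x ++ i) = x :: species i.
Proof.
move=> a0 xi; rewrite /species rev_cat undup_cat rev_cat.
have -> : undup (rev (nseq a x)) = [:: x].
  rewrite rev_nseq.
  by case: a a0 => // a _; elim: a => //= a ->; rewrite mem_head.
congr (_ :: rev _); apply/all_filterP/allP => y; rewrite mem_undup !mem_rev => yi.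
by rewrite mem_nseq a0 /=; apply: contraNneq xi => <-.
Qed.

Fixpoint blocks (xs : seq T) p : seq T :=
  match xs, p with x :: xs', a :: p' => nseq a x ++ blocks xs' p' | _, _ => [::] end.

Lemma blocksP xs p : uniq xs -> size xs = size p -> all (leq 1) p ->
  species (blocks xs p) = xs /\ counts (blocks xs p) = p.
Proof.
elim: xs p => [|x xs ih] [|a p] //= /andP[xxs uxs] [sz] /andP[a0 p1].
have [s1 s2] := ih p uxs sz p1.
have xb : x \notin blocks xs p by rewrite -mem_species s1.
have sE : species (nseq a x ++ blocks xs p) = x :: xs by rewrite species_block// s1.
split => //; rewrite /counts sE /= count_cat count_nseq /= eqxx mul1n.
rewrite (count_memPn xb) addn0; congr (_ :: _).
rewrite -[RHS]s2 /counts s1; apply/eq_in_map => y yxs; rewrite count_cat count_nseq /=.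
by case: eqP => // xy; rewrite xy yxs in xxs.
Qed.

Lemma size_blocks xs p : size xs = size p -> size (blocks xs p) = sumn p.
Proof.
by elim: xs p => [|x xs ih] [|a p] //= [/ih sz]; rewrite size_cat size_nseq sz.
Qed.

Fixpoint monomial (R : comNzRingType) (g : T -> R) (xs : seq T) p : R :=
  match xs, p with x :: xs', a :: p' => g x ^+ a * monomial g xs' p' | _, _ => 1 end.

Lemma prod_monomial (R : comNzRingType) (g : T -> R) i :
  \prod_(x <- i) g x = monomial g (species i) (counts i).
Proof.
have E xs (h : T -> nat) :
    monomial g xs [seq h x | x <- xs] = \prod_(x <- xs) g x ^+ h x.
  by elim: xs => [|x xs /= ->]; rewrite ?big_nil ?big_cons.
rewrite /counts E; elim/last_ind: i => [|i x ih]; first by rewrite !big_nil.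
rewrite -cats1 big_cat big_seq1 ih cats1 species_rcons /=; case: ifPn => xi.
  rewrite -mem_species in xi.
  rewrite [LHS]mulrC (bigD1_seq x) ?species_uniq//= [RHS](bigD1_seq x) ?species_uniq//=.
  rewrite -cats1 count_cat /= eqxx addn0 addn1 exprS -mulrA; congr (_ * (_ * _)).
  apply: eq_bigr => y yx; rewrite count_cat /= eq_sym (negbTE yx) !addn0//.
rewrite -[rcons (species i) x]cats1 big_cat big_seq1 /= -cats1 count_cat /= eqxx.
rewrite (count_memPn xi) expr1; congr (_ * _).
apply: eq_big_seq => y; rewrite mem_species => yi.
rewrite count_cat /= addn0; case: eqP => [xy|]; last by rewrite addn0.
by rewrite xy yi in xi.
Qed.

End Species.

Lemma species_map (T T' : eqType) (F : T -> T') i : injective F ->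
  species (map F i) = map F (species i).
Proof. by move=> Fi; rewrite /species -map_rev undup_map_inj// map_rev. Qed.

Lemma counts_map (T T' : eqType) (F : T -> T') i : injective F ->
  counts (map F i) = counts i.
Proof.
move=> Fi; rewrite /counts species_map// -map_comp; apply: eq_map => x /=.
by rewrite count_map; apply: eq_count => y /=; rewrite (inj_eq Fi).
Qed.

Lemma abundance_counts (I : nat -> nat) n :
  abundance (fun l m => I l == I m) n = counts (map I (iota 0 n)).
Proof.
rewrite /abundance /counts.
have -> : species (map I (iota 0 n)) =
    map I [seq l <- iota 0 n | ~~ has (fun m => I l == I m) (iota 0 l)].
  elim: n => // n ih; rewrite -addn1 iotaD add0n cats1 map_rcons species_rcons ih.
  rewrite filter_rcons.
  have -> : has (fun m => I n == I m) (iota 0 n) = (I n \in map I (iota 0 n)).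
    apply/hasP/mapP => [[m mn /eqP E]|[m mn ->]]; exists m => //.
  by case: ifP; rewrite ?map_rcons.
rewrite -map_comp; apply: eq_map => l /=; rewrite count_map.
by apply: eq_count => m /=; rewrite eq_sym.
Qed.

Lemma eq_abundance (r1 r2 : rel nat) n :
  (forall l m, (l < n)%N -> (m < n)%N -> r1 l m = r2 l m) ->
  abundance r1 n = abundance r2 n.
Proof.
move=> r12; rewrite /abundance.
rewrite (@eq_in_filter _ (fun l => ~~ has (r1 l) (iota 0 l))
  (fun l => ~~ has (r2 l) (iota 0 l))); last first.
  move=> l; rewrite mem_iota add0n /= => ln; congr (~~ _).
  by apply: eq_in_has => m; rewrite mem_iota add0n /= => ml; rewrite r12// (ltn_trans ml).
apply/eq_in_map => l; rewrite mem_filter mem_iota add0n /= => /andP[_ ln].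
by apply: eq_in_count => m; rewrite mem_iota add0n /= => mn; exact: r12.
Qed.

Section SamplingIdentity.
Variables (R : comNzRingType) (T : finType) (g : T -> R).

Lemma big_tuple_cons k (G : k.+1.-tuple T -> R) :
  \sum_t G t = \sum_x \sum_(t : k.-tuple T) G [tuple of x :: t].
Proof.
rewrite pair_big /=.
rewrite (reindex (fun z : T * k.-tuple T => [tuple of z.1 :: z.2]))//=.
exists (fun t => (thead t, [tuple of behead t])) => [[x t] _|t _] /=.
  by congr pair; exact: val_inj.
by rewrite -tuple_eta.
Qed.

Lemma sum_prod_tuple n :
  \sum_(f : n.-tuple T) \prod_(x <- f) g x = (\sum_x g x) ^+ n.
Proof.
elim: n => [|n ih].
  by rewrite (big_pred1 [tuple]) ?big_nil// => t; apply/esym/eqP/val_inj; case: t => -[].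
rewrite big_tuple_cons exprS mulr_suml; apply: eq_bigr => x _.
by rewrite -ih mulr_sumr; apply: eq_bigr => t _; rewrite big_cons.
Qed.

(** For finitely many atoms the recursive definition is the sum over tuples of
    distinct indices. *)
Lemma distinct_sumE p : distinct_sum (fun m => \sum_x g x ^+ m) p =
  \sum_(J : (size p).-tuple T | uniq J) monomial g J p.
Proof.
elim/size_ind: p => [|m p ih].
  by rewrite (big_pred1 [tuple])//= => -[[]//= st]; apply/esym/eqP/val_inj.
have shift J : size J = size p -> (\sum_(x <- J) g x ^+ m) * monomial g J p =
    \sum_(q <- bumps m p) monomial g J q.
  elim: p J {ih} => [|a p ihp] [|x J] //=; first by rewrite !big_nil mul0r.
  move=> [sJ]; rewrite !big_cons big_map /= -mulr_sumr -ihp// exprD; ring.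
rewrite distinct_sum_cons ih// (eq_big_seq (fun q =>
    \sum_(J : (size p).-tuple T | uniq J) monomial g J q)); last first.
  by move=> q qb; have sq := size_bumps qb; rewrite ih// -sq.
rewrite [X in _ - X]exchange_big [RHS]big_mkcond big_tuple_cons [RHS]exchange_big /=.
rewrite mulr_sumr.
rewrite -sumrB [LHS]big_mkcond /=; apply: eq_bigr => J _.
case: ifP => [uJ|nuJ]; last by rewrite big1// => x _; rewrite andbF.
rewrite -shift ?size_tuple// -mulrBl.
under [RHS]eq_bigr do rewrite andbT.
rewrite -big_mkcond /= -mulr_suml; congr (_ * _).
have -> : \sum_x g x ^+ m = \sum_(x in J) g x ^+ m + \sum_(x | x \notin J) g x ^+ m.
  exact: (bigID (fun x => x \in J)).
by rewrite big_uniq//= addrC addrA addNr add0r.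
Qed.

End SamplingIdentity.

(** The number of ways to sort n individuals into species discovered in the
    order of their labels, with abundances p. *)
Definition pattern_count n p := #|[set h : n.-tuple 'I_(size p) |
  (species h == enum 'I_(size p)) && (counts h == p)]%SET|.

Lemma pattern_count_gt0 n p : abundance_vectors n p -> (0 < pattern_count n p)%N.
Proof.
move=> /andP[p1 /eqP pn]; have sz : size (enum 'I_(size p)) = size p.
  by rewrite size_enum_ord.
have [s1 s2] := blocksP (enum_uniq 'I_(size p)) sz p1.
have sb : size (blocks (enum 'I_(size p)) p) == n by rewrite size_blocks// pn.
apply/card_gt0P; exists (Tuple sb).
by rewrite inE /= s1 s2 !eqxx.
Qed.

(** Renaming the species does not change the number of samples. *)
Lemma card_pattern (T : finType) n p (J : (size p).-tuple T) : uniq J ->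
  #|[set f : n.-tuple T | (species f == J) && (counts f == p)]%SET| = pattern_count n p.
Proof.
move=> uJ; pose F := tnth J.
have Fi : injective F by move=> i j; exact: tuple_uniqP.
have JE : tval J = map F (enum 'I_(size p)) by rewrite map_tnth_enum.
rewrite /pattern_count -(card_imset _ (f := map_tuple F)); last first.
  by move=> h h' /(congr1 val) /= /(inj_map Fi) E; exact: val_inj.
apply: eq_card => f; rewrite inE; apply/andP/imsetP => [[/eqP sf /eqP cf]|[h]].
  have [h hE] : exists h, tval f = map F h.
    have : forall x, x \in tval f -> x \in J by move=> x; rewrite -mem_species sf.
    elim: (tval f) => [|x l ih] lJ; first by exists [::].
    have [h ->] : exists h, l = map F h.
      by apply: ih => y yl; apply: lJ; rewrite in_cons yl orbT.
    have /tnthP[i ->] := lJ x (mem_head _ _); by exists (i :: h).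
  have sh : size h == n by rewrite -(size_map F) -hE size_tuple.
  exists (Tuple sh); last exact: val_inj.
  rewrite inE /= -(inj_eq (inj_map Fi)) -species_map// -hE sf -JE eqxx /=.
  by rewrite -(counts_map _ Fi) -hE cf.
rewrite inE => /andP[/eqP sh /eqP ch] ->.
by rewrite /= species_map// counts_map// sh ch JE.
Qed.

(** Grouping the samples by the list J of their species in order of
    appearance: all the samples of a group have the same weight, and the number
    of samples in a group does not depend on J. *)
Lemma sampling_identity (R : comNzRingType) (T : finType) (g : T -> R) n p :
  \sum_(f : n.-tuple T | counts f == p) \prod_(x <- f) g x =
  (pattern_count n p)%:R * distinct_sum (fun m => \sum_x g x ^+ m) p.
Proof.
rewrite distinct_sumE mulr_sumr.
transitivity (\sum_(f : n.-tuple T | counts f == p)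
    \sum_(J : (size p).-tuple T | uniq J && (species f == J)) monomial g J p).
  apply: eq_bigr => f /eqP cf.
  have sf : size (species f) == size p by rewrite -cf size_map.
  rewrite (big_pred1 (Tuple sf)) /=; first by rewrite prod_monomial cf.
  move=> J; apply/andP/eqP => [[_ /eqP E]|->]; first exact/val_inj.
  by rewrite /= species_uniq.
under eq_bigr do rewrite big_mkcondr.
rewrite exchange_big /=; apply: eq_bigr => J uJ.
rewrite -big_mkcondr /= sumr_const mulr_natl; congr (_ *+ _).
rewrite -(card_pattern n uJ); apply: eq_card => f.
by rewrite !inE andbC.
Qed.

(** * Sampling from the intervals *)

Definition label_seqs n N (F : pred (seq nat)) : seq (seq nat) :=
  [seq map val (tval t) | t <- [seq t <- enum {: n.-tuple 'I_N} | F (map val (tval t))]].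

Section LabelSeqs.
Variables (n N : nat) (F : pred (seq nat)).

Lemma mem_label_seqs f :
  (f \in label_seqs n N F) = [&& size f == n, all (ltn^~ N) f & F f].
Proof.
apply/mapP/and3P => [[t]|[sf fN Ff]].
  rewrite mem_filter => /andP[Ft _] ->; rewrite size_map size_tuple; split => //.
  by apply/allP => _ /mapP[i _ ->] /=; exact: ltn_ord.
have [h hE] : exists h : seq 'I_N, f = map val h.
  elim: f fN {sf Ff} => [|x f ih] /=; first by exists [::].
  by move=> /andP[xN /ih[h ->]]; exists (Ordinal xN :: h).
have sh : size h == n by rewrite -(size_map val) -hE.
by exists (Tuple sh) => //; rewrite mem_filter /= -hE Ff mem_enum.
Qed.

Lemma label_seqs_uniq : uniq (label_seqs n N F).
Proof.
rewrite map_inj_uniq; first by apply: filter_uniq; exact: enum_uniq.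
by move=> t t' /(inj_map val_inj) E; exact: val_inj.
Qed.

Lemma big_label_seqs (R : comNzRingType) (g : nat -> R) :
  \sum_(f <- label_seqs n N F) \prod_(x <- f) g x =
  \sum_(t : n.-tuple 'I_N | F (map val t)) \prod_(x <- t) g (val x).
Proof.
rewrite big_map big_filter big_enum_cond /=.
by apply: eq_bigr => t _; rewrite big_map.
Qed.

End LabelSeqs.

Section SampledIntervals.
Context (R : realType) (left : nat -> seqspace R -> R).
Hypothesis left_intervals : interval_system left.
Local Notation space := (seqspace R).
Variable n : nat.

Definition in_interval i (s : space) (x : R) := left i s < x < left i s + s i.

(** A frequency sequence and a sample whose individual l falls in the interval
    number f l.  Membership in Sdown is included because the endpoints are only
    measurable there. *)
Definition box (f : seq nat) : set (space * space) :=
  [set z | Sdown z.1 /\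
     forall l, (l < size f)%N -> in_interval (nth 0%N f l) z.1 (z.2 l)].

Definition boxes F N := \bigcup_(f in [set` label_seqs n N F]) box f.

Definition boxset F := \bigcup_N boxes F N.

Lemma measurable_in_interval i l : measurable
  [set z : space * space | Sdown z.1 /\ in_interval i z.1 (z.2 l)].
Proof.
have [mleft _] := left_intervals; have mS := @measurable_Sdown R.
pose left' := left i \_ (@Sdown R : set space).
have mleft' : measurable_fun setT left'.
  by apply/(measurable_restrictT _ _).1 => //; exact: mleft.
have m1 : measurable_fun setT (fun z : space * space => left' z.1).
  exact: (measurableT_comp mleft' measurable_fst).
have m2 : measurable_fun setT (fun z : space * space => z.1 i).
  exact: (measurableT_comp (measurable_coord i) measurable_fst).
have m3 : measurable_fun setT (fun z : space * space => z.2 l).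
  exact: (measurableT_comp (measurable_coord l) measurable_snd).
have mlt (G H : space * space -> R) : measurable_fun setT G -> measurable_fun setT H ->
    measurable [set z | G z < H z].
  move=> mG mH; rewrite (_ : [set z | G z < H z] = ~` [set z | H z <= G z]); last first.
    by apply/seteqP; split => z /=; rewrite ltNge => /negP.
  by apply: measurableC; rewrite -[X in measurable X]setTI; exact: measurable_fun_le.
rewrite (_ : [set z : space * space | _] = ((@Sdown R : set space) `*` setT) `&`
  ([set z | left' z.1 < z.2 l] `&` [set z | z.2 l < left' z.1 + z.1 i])); last first.
  have lE s : Sdown s -> left' s = left i s by move=> ss; rewrite /left' patchE mem_set.
  apply/seteqP; split => z /=.
    by move=> [zs /andP[h1 h2]]; rewrite lE.
  by move=> [[zs _]]; rewrite lE// => -[h1 h2]; split => //; apply/andP.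
apply: measurableI; first exact: measurableX.
by apply: measurableI; apply: mlt => //; exact: measurable_funD.
Qed.

Lemma measurable_box f : measurable (box f).
Proof.
have -> : box f = ((@Sdown R : set space) `*` setT) `&` \bigcap_(l in `I_(size f))
    [set z : space * space | Sdown z.1 /\ in_interval (nth 0%N f l) z.1 (z.2 l)].
  apply/seteqP; split => z.
    by move=> [zs h]; split => // l /= lf; split => //; exact: h.
  by move=> [[zs _] h]; split => // l lf; have [] := h l lf.
apply: measurableI; first by apply: measurableX => //; exact: measurable_Sdown.
by apply: bigcap_measurableType => l _; exact: measurable_in_interval.
Qed.

Lemma measurable_boxes F N : measurable (boxes F N).
Proof.
by apply: fin_bigcup_measurable => // f _; exact: measurable_box.
Qed.

Lemma measurable_boxset F : measurable (boxset F).
Proof. by apply: bigcup_measurable => N _; exact: measurable_boxes. Qed.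

Lemma boxes_nd F : nondecreasing_seq (boxes F).
Proof.
move=> N M NM; apply/subsetPset => z [f /=]; rewrite mem_label_seqs => /and3P[sf fN Ff] zf.
exists f => //=; rewrite mem_label_seqs sf Ff andbT /=.
by apply: sub_all fN => i /= iN; exact: leq_trans NM.
Qed.

Lemma interval_unique s x i j : Sdown s ->
  in_interval i s x -> in_interval j s x -> i = j.
Proof.
have [_ tr] := left_intervals; move=> /tr [_ tI] ix jx.
by apply: (tI i j I I); exists x; split; rewrite /= in_itv.
Qed.

Lemma box_unique f f' z : size f = size f' -> box f z -> box f' z -> f = f'.
Proof.
move=> ff' [zs h] [_ h']; apply: (@eq_from_nth _ 0%N) => // l lf.
by apply: (interval_unique zs (h l lf)); apply: h'; rewrite -ff'.
Qed.

(** Off the dust, two individuals are of the same species when their labels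
    agree. *)
Lemma box_abundance s x f : size f = n -> box f (s, x) ->
  abundance (same_species left s x) n = counts f.
Proof.
move=> sf [ss h]; rewrite -[in RHS](mkseq_nth 0%N f) sf -abundance_counts.
apply: eq_abundance => l m ln mn; rewrite /same_species.
rewrite -sf in ln mn; have hl := h l ln; have hm := h m mn.
apply/asboolP/eqP => [[->//|[i [il im]]]|E]; last first.
  right; exists (nth 0%N f l); rewrite !in_itv /=; split; first exact: hl.
  by rewrite E; exact: hm.
rewrite !in_itv /= in il im.
by rewrite (interval_unique ss hl il) (interval_unique ss hm im).
Qed.

Section fixed_frequencies.
Context d (Omega : measurableType d) (Pr : probability Omega R).
Variables (X : nat -> {RV Pr >-> R}) (XX : {RV Pr >-> space}).
Hypothesis X_iid : iid_uniform X.
Hypothesis XXE : forall w, XX w = (fun l => X l w).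

Lemma interval_prob s i l : Sdown s ->
  Pr (X l @^-1` [set x | in_interval i s x]) = (s i)%:E.
Proof.
move=> ss; have [_ unif] := X_iid; have [s0 _] := Sdown_mass_one ss.
have [sub _] := left_intervals.2 s ss.
pose I : set R := [set` `]left i s, left i s + s i[].
have E : [set x | in_interval i s x] = I.
  by rewrite /I; apply/seteqP; split => x /=; rewrite in_itv.
have mI : measurable [set x | in_interval i s x] by rewrite E; exact: measurable_itv.
have -> : Pr (X l @^-1` [set x | in_interval i s x]) =
    distribution Pr (X l) [set x | in_interval i s x] by [].
rewrite unif// /uniform_prob E.
transitivity (\int[lebesgue_measure]_(x in I) (cst 1 x))%E.
  apply: eq_integral => x; rewrite inE => /sub; rewrite /= in_itv /= /uniform_pdf => ->.
  by rewrite subr0 invr1.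
rewrite integral_cst//= mul1e lebesgue_measure_itv /= lte_fin ltrDl.
case: ifPn => [_|]; first by rewrite -EFinD addrAC subrr add0r.
by rewrite -leNgt => si; congr (_%:E); apply/eqP; rewrite eq_le si s0.
Qed.

Lemma box_prob s f : Sdown s -> size f = n ->
  distribution Pr XX (xsection (box f) s) = (\prod_(j <- f) s j)%:E.
Proof.
move=> ss sf; have [indep _] := X_iid.
have mI i : measurable [set x | in_interval i s x].
  rewrite (_ : [set x | _] = [set` `]left i s, left i s + s i[]); first exact: measurable_itv.
  by apply/seteqP; split => x /=; rewrite in_itv.
rewrite /distribution /pushforward.
rewrite (_ : XX @^-1` _ = \bigcap_(l in [set` iota 0 n])
    (X l @^-1` [set x | in_interval (nth 0%N f l) s x])); last first.
  apply/seteqP; split => w /=; rewrite /xsection /= inE.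
    by move=> [_ h] l /=; rewrite mem_iota /= add0n -sf => /h; rewrite XXE.
  move=> h; split => // l; rewrite sf => ln; rewrite XXE.
  by apply: h; rewrite /= mem_iota.
rewrite indep ?iota_uniq//.
rewrite (eq_bigr (fun l => (s (nth 0%N f l))%:E)); last first.
  by move=> l _; exact: interval_prob.
rewrite prodEFin; congr (_%:E); rewrite -[in RHS](mkseq_nth 0%N f) sf big_map.
by [].
Qed.

Lemma boxes_prob s F N : Sdown s -> distribution Pr XX (xsection (boxes F N) s) =
  (\sum_(f <- label_seqs n N F) \prod_(j <- f) s j)%:E.
Proof.
move=> ss; rewrite /boxes.
have -> : xsection (\bigcup_(f in [set` label_seqs n N F]) box f) s =
    \bigcup_(f in [set` label_seqs n N F]) xsection (box f) s.
  apply/seteqP; split => x; rewrite /xsection /=.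
    by rewrite inE => -[f ff h]; exists f => //=; rewrite inE.
  by move=> [f ff]; rewrite /= !inE => h; exists f.
rewrite measure_fin_bigcup; last 3 first.
- exact: finite_seq.
- move=> f f' /=; rewrite !mem_label_seqs => /and3P[/eqP sf _ _] /and3P[/eqP sf' _ _].
  by move=> [x []]; rewrite /xsection /= !inE; apply: box_unique; rewrite sf sf'.
- by move=> f _; apply: measurable_xsection; exact: measurable_box.
rewrite -fsbig_seq ?label_seqs_uniq// -sumEFin big_seq [RHS]big_seq.
apply: eq_bigr => f; rewrite mem_label_seqs => /and3P[/eqP sf _ _].
exact: box_prob.
Qed.

(** Truncating the labels at N reduces the probability to a finite sum. *)
Lemma boxset_prob s F : Sdown s ->
  (\sum_(f <- label_seqs n N F) \prod_(j <- f) s j)%:E @[N --> \oo] -->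
  distribution Pr XX (xsection (boxset F) s).
Proof.
move=> ss.
have -> : (fun N => (\sum_(f <- label_seqs n N F) \prod_(j <- f) s j)%:E) =
    (fun N => distribution Pr XX (xsection (boxes F N) s)).
  by apply/funext => N; rewrite boxes_prob.
rewrite /boxset xsection_bigcup; apply: nondecreasing_cvg_mu.
- by move=> N; apply: measurable_xsection; exact: measurable_boxes.
- by apply: bigcup_measurable => N _; apply: measurable_xsection; exact: measurable_boxes.
- move=> N M NM; apply/subsetPset => x; rewrite /xsection /= !inE.
  by have /subsetPset := boxes_nd F NM; apply.
Qed.

Lemma boxset_prob_abundance s p : Sdown s -> all (leq 1) p ->
  distribution Pr XX (xsection (boxset (fun f => counts f == p)) s) =
  ((pattern_count n p)%:R * dsum s p)%:E.
Proof.
move=> ss p1; have sm := Sdown_mass_one ss.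
have L := @boxset_prob s (fun f => counts f == p) ss.
apply: (cvg_unique (@ereal_hausdorff R) L).
apply: cvg_EFin; first by near=> N.
rewrite (_ : _ \o _ =
    fun N => (pattern_count n p)%:R * distinct_sum (partial_psum s N) p).
  by apply: cvgMr; exact: dsum_cvg.
apply/funext => N /=; rewrite big_label_seqs.
under eq_bigl do rewrite (counts_map _ val_inj).
by rewrite sampling_identity.
Unshelve. all: by end_near. Qed.

Lemma boxset_prob_full s : Sdown s ->
  distribution Pr XX (xsection (boxset predT) s) = 1%E.
Proof.
move=> ss; have sm := Sdown_mass_one ss.
have L := @boxset_prob s predT ss.
apply: (cvg_unique (@ereal_hausdorff R) L).
apply: cvg_EFin; first by near=> N.
rewrite (_ : _ \o _ = fun N => partial_psum s N 1 ^+ n).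
  suff : partial_psum s N 1 ^+ n @[N --> \oo] --> (1 : R) ^+ n by rewrite expr1n.
  rewrite -(psum1 sm); elim: (n) => [|k ih].
    by under eq_fun do rewrite expr0; rewrite expr0; exact: cvg_cst.
  under eq_fun do rewrite exprS; rewrite exprS.
  by apply: cvgM => //; exact: partial_psum_cvg.
by apply/funext => N /=; rewrite big_label_seqs sum_prod_tuple.
Unshelve. all: by end_near. Qed.

End fixed_frequencies.

End SampledIntervals.

(** Only finitely many comparisons matter, so the event is a finite union over
    their possible outcomes. *)
Lemma measurable_abundance d (T : measurableType d) (r : T -> rel nat) n p :
  (forall l m, measurable [set w | r w l m]) ->
  measurable [set w | abundance (r w) n = p].
Proof.
move=> mr; pose B := {ffun 'I_n.+1 * 'I_n.+1 -> bool}.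
pose rM (M : B) : rel nat := fun l m => M (inord l, inord m).
rewrite (_ : [set w | _] = \bigcup_(M in [set M : B | abundance (rM M) n = p])
    \bigcap_(z in [set: 'I_n.+1 * 'I_n.+1]) [set w | r w z.1 z.2 = M z]); last first.
  apply/seteqP; split => w /=.
    move=> E; exists [ffun z : 'I_n.+1 * 'I_n.+1 => r w z.1 z.2].
      rewrite /= -E; apply: eq_abundance => l m ln mn.
      by rewrite /rM ffunE /= !inordK// ltnS ltnW.
    by move=> z _ /=; rewrite ffunE.
  move=> [M /= <- h]; apply: eq_abundance => l m ln mn.
  by have := h (inord l, inord m) I; rewrite /rM /= !inordK// ltnS ltnW.
apply: fin_bigcup_measurable => [|M _]; first exact: finite_finset.
apply: fin_bigcap_measurable => [|z _]; first exact: finite_finset.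
case: (M z); first exact: mr.
rewrite (_ : [set w | _] = ~` [set w | r w z.1 z.2]); first exact/measurableC/mr.
by apply/seteqP; split => w /= => [->//|/negP/negbTE].
Qed.

Section PosteriorWeights.
Context d (Omega : measurableType d) (R : realType) (Pr : probability Omega R).
Variables (alpha theta : R) (P : probability (seqspace R) R).
Variables (S : {RV Pr >-> seqspace R}) (X : nat -> {RV Pr >-> R}).
Variable left : nat -> seqspace R -> R.
Hypotheses (alpha_ge0 : 0 <= alpha) (alpha_lt1 : alpha < 1).
Hypothesis theta_gt : - alpha < theta.
Hypothesis P_PDP : is_PDP alpha theta P.
Hypothesis S_Sdown : forall w, Sdown (S w).
Hypothesis S_law : forall A, measurable A -> distribution Pr S A = P A.
Hypothesis X_iid : iid_uniform X.
Hypothesis SX_indep : independent_of_sample S X.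
Hypothesis left_intervals : interval_system left.
Local Notation space := (seqspace R).

Let mXX : measurable_fun setT ((fun w l => X l w) : Omega -> space).
Proof.
apply: (@measurability _ _ Omega space setT _ (cylinders R) erefl).
move=> _ [_ [i _ [B mB <-]] <-]; rewrite setTI.
rewrite (_ : _ @^-1` _ = X i @^-1` B); last first.
  by apply/seteqP; split => w /=; [case|].
by rewrite -[X in measurable X]setTI; exact: measurable_funPT.
Qed.

Let XX_mfun := isMeasurableFun.Build _ _ _ _ ((fun w l => X l w) : Omega -> space) mXX.

Let XX : {mfun Omega >-> space} := HB.pack ((fun w l => X l w) : Omega -> space) XX_mfun.

Let pair w : space * space := (S w, XX w).

Let mpair : measurable_fun setT pair.
Proof. by apply/measurable_fun_pairP; split; exact: measurable_funPT. Qed.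

Let mpreimage B : measurable B -> measurable (pair @^-1` B).
Proof. by move=> mB; rewrite -[X in measurable X]setTI; exact: mpair. Qed.

Lemma measurable_abundance_event n p : measurable (abundance_event S X left n p).
Proof.
apply: measurable_abundance => l m.
rewrite (_ : [set w | _] = [set w | l = m] `|` \bigcup_i pair @^-1`
    ([set z : space * space | Sdown z.1 /\ in_interval left i z.1 (z.2 l)] `&`
     [set z : space * space | Sdown z.1 /\ in_interval left i z.1 (z.2 m)])); last first.
  apply/seteqP; split => w.
    move=> /asboolP[->|[i]]; first by left.
    rewrite !in_itv /= => -[h1 h2]; right; exists i => //.
    by split; split => //; exact: S_Sdown.
  move=> [/= lm|[i _ [[_ h1] [_ h2]]]]; apply/asboolP; first by left.
  by right; exists i; rewrite !in_itv.
apply: measurableU.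
  have [lm|lm] := pselect (l = m).
    rewrite (_ : [set _ | _] = setT); first exact: measurableT.
    by apply/seteqP; split.
  rewrite (_ : [set _ | _] = set0); first exact: measurable0.
  by apply/seteqP; split => w.
apply: bigcupT_measurable => i; apply: mpreimage; apply: measurableI;
  exact: measurable_in_interval.
Qed.

(** The law of the sample given S is computed interval by interval; the points
    outside all intervals form a null event. *)
Lemma integral_abundance_event n p (G : space -> \bar R) : all (leq 1) p ->
  measurable_fun setT G -> (forall s, 0 <= G s)%E ->
  (\int[Pr]_(w in abundance_event S X left n p) G (S w) =
   (pattern_count n p)%:R%:E * \int[Pr]_w (G (S w) * (dsum (S w) p)%:E))%E.
Proof.
move=> p1 mG G0.
have indep A B : measurable A -> measurable B ->
    (Pr (S @^-1` A `&` XX @^-1` B) = Pr (S @^-1` A) * Pr (XX @^-1` B))%E.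
  exact: SX_indep.
have mGS : measurable_fun setT (fun w => G (S w)).
  by apply: (@measurableT_comp _ _ _ _ _ _ G _ S).
have mbox F : measurable (boxset left n F) by exact: measurable_boxset.
have sections F (H : space -> \bar R) : measurable_fun setT H -> (forall s, 0 <= H s)%E ->
    (\int[Pr]_w (H (S w) * (\1_(boxset left n F) (pair w))%:E) =
     \int[Pr]_w (H (S w) * distribution Pr XX (xsection (boxset left n F) (S w))))%E.
  move=> mH H0.
  pose h z := (H z.1 * (\1_(boxset left n F) z)%:E)%E.
  have mh : measurable_fun setT h.
    apply: emeasurable_funM; first exact: (measurableT_comp mH measurable_fst).
    by apply/measurable_EFinP; exact: measurable_indic.
  have h0 z : (0 <= h z)%E by rewrite mule_ge0 ?lee_fin.
  have := @integral_independent_pair _ _ _ _ _ _ _ Pr S XX indep h mh h0.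
  rewrite /h /pair /= => ->; apply: eq_integral => w _.
  rewrite ge0_integralZl//; last first.
    apply/measurable_EFinP.
    rewrite (_ : (fun y => _) = \1_(xsection (boxset left n F) (S w))).
      by apply: measurable_indic; exact: measurable_xsection.
    by apply/funext => y; rewrite !indicE mem_xsection.
  congr (_ * _)%E; rewrite -[xsection _ _ in RHS]setIT -integral_indic//; last exact: measurable_xsection.
  by apply: eq_integral => y _; rewrite !indicE mem_xsection.
(* The event that some individual falls outside all the intervals. *)
pose N := ~` (pair @^-1` boxset left n predT).
have mN : measurable N by apply/measurableC/mpreimage.
have N0 : Pr N = 0%E.
  rewrite probability_setC; last exact: mpreimage.
  have := sections predT (cst 1%E) (measurable_cst _) (fun=> lee01).
  rewrite (_ : (\int[Pr]_w _)%E = Pr (pair @^-1` boxset left n predT)); last first.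
    rewrite -[pair @^-1` _ in RHS]setIT -integral_indic//; last exact: mpreimage.
    by apply: eq_integral => w _; rewrite /= mul1e !indicE.
  move=> ->; rewrite (_ : (\int[Pr]_w _)%E = 1%E) ?subee//.
  rewrite (eq_integral (cst 1%E)) ?integral_cst// ?mul1e; first exact: probability_setT.
  by move=> w _; rewrite /= mul1e (boxset_prob_full left_intervals n X_iid).
have mev := measurable_abundance_event n p.
rewrite integral_mkcond.
transitivity (\int[Pr]_w (G (S w) *
    (\1_(boxset left n (fun f => counts f == p)) (pair w))%:E))%E.
  apply: ge0_ae_eq_integral => //.
  - by apply/(measurable_restrictT _ _).1 => //; exact: measurable_funTS.
  - apply: emeasurable_funM => //; apply/measurable_EFinP.
    by apply: (measurableT_comp _ mpair); exact: measurable_indic.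
  - by move=> w _; apply: erestrict_ge0.
  - by move=> w _; rewrite mule_ge0 ?lee_fin.
  exists N; split => // w /= /not_implyP[_ ne]; apply: contrapT => wN; apply: ne.
  have {wN} : boxset left n predT (pair w) by apply: contrapT.
  move=> [M _ [f /=]]; rewrite mem_label_seqs => /and3P[/eqP sf fM _] fw.
  rewrite patchE indicE.
  have := box_abundance left_intervals sf fw => ab.
  rewrite (_ : (w \in abundance_event S X left n p) =
    (pair w \in boxset left n (fun f => counts f == p))); last first.
    apply/idP/idP; rewrite !inE /abundance_event /=.
      rewrite ab => cf; exists M => //; exists f => //.
      by rewrite /= mem_label_seqs sf fM cf !eqxx.
    move=> [M' _ [f' /=]]; rewrite mem_label_seqs => /and3P[/eqP sf' _ /eqP cf'] fw'.
    by rewrite ab -cf' (box_unique left_intervals _ fw fw')// sf sf'.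
  by case: ifPn => _; rewrite ?mule1 ?mule0.
rewrite sections//.
under eq_integral do rewrite (boxset_prob_abundance left_intervals n X_iid)// EFinM muleCA.
rewrite ge0_integralZl//.
- apply: emeasurable_funM => //; apply/measurable_EFinP.
  exact: measurable_dsum_comp.
- by move=> w _; rewrite mule_ge0// lee_fin dsum_ge0//; exact: Sdown_mass_one.
Qed.

Lemma abundance_event_prob n p : all (leq 1) p ->
  Pr (abundance_event S X left n p) =
  ((pattern_count n p)%:R * eppf alpha theta p)%:E.
Proof.
move=> p1; have mev := measurable_abundance_event n p.
rewrite -[LHS]mul1e -integral_cst//.
rewrite (@integral_abundance_event n p (cst 1%E))//.
under eq_integral do rewrite mul1e.
by rewrite (expected_dsum alpha_ge0 alpha_lt1 theta_gt P_PDP).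
Qed.

(** The number of patterns cancels in the posterior mean.  [G] is a version of
    the functional that is nonnegative and measurable on all sequences. *)
Lemma posterior_meanE (H : (nat -> R) -> \bar R) (G : space -> \bar R) n p v :
  abundance_vectors n p -> measurable_fun setT G -> (forall s, 0 <= G s)%E ->
  (forall s, Sdown s -> H s = G s) ->
  (\int[Pr]_w (G (S w) * (dsum (S w) p)%:E) = (eppf alpha theta p * v)%:E)%E ->
  posterior_mean S X left H n p = v%:E.
Proof.
move=> pn mG G0 HG I; have p1 : all (leq 1) p by case/andP: pn.
rewrite /posterior_mean /cond_mean abundance_event_prob//.
rewrite (eq_integral (fun w => G (S w))); last by move=> w _; rewrite HG.
rewrite integral_abundance_event// I.
have c0 : 0 < (pattern_count n p)%:R :> R by rewrite ltr0n pattern_count_gt0.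
have F0 := eppf_gt0 alpha_lt1 p alpha_ge0 theta_gt.
rewrite inver (gt_eqF (mulr_gt0 c0 F0)) -!EFinM; congr (_%:E).
by field; rewrite (gt_eqF c0) (gt_eqF F0).
Qed.

End PosteriorWeights.

(** * Posterior means of the entropy and of the Gini functions *)

Section EntropyExpansion.
Variable R : realType.
Implicit Types s : nat -> R.

(** The coefficients of s * (1 - s) ^ m in the powers s ^ r.+1. *)
Definition binomial_coefs m : seq (R * nat) :=
  [seq ((-1) ^+ r * 'C(m, r)%:R, r) | r <- iota 0 m.+1].

Definition psum_combination (l : seq (R * nat)) s : R :=
  \sum_(x <- l) x.1 * psum s x.2.+1.

Lemma binomial_coefsE m (x : R) :
  \sum_(z <- binomial_coefs m) z.1 * x ^+ z.2.+1 = x * (1 - x) ^+ m.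
Proof.
rewrite big_map exprBn mulr_sumr -[iota 0 m.+1]/(index_iota 0 m.+1) big_mkord.
apply: eq_bigr => r _ /=; rewrite expr1n mulr1 -mulr_natr exprS; ring.
Qed.

Lemma binomial_psum s m : mass_one s ->
  (\sum_(0 <= i <oo) (s i * (1 - s i) ^+ m)%:E =
   (psum_combination (binomial_coefs m) s)%:E)%E.
Proof.
move=> sm; apply/cvg_lim => //.
apply: cvg_EFin; first by near=> N; rewrite sumEFin.
rewrite (_ : _ \o _ = fun N => \sum_(z <- binomial_coefs m) z.1 * partial_psum s N z.2.+1).
  rewrite /psum_combination; elim: (binomial_coefs m) => [|z l ih].
    by rewrite big_nil; under eq_fun do rewrite big_nil; exact: cvg_cst.
  rewrite big_cons; under eq_fun do rewrite big_cons.
  by apply: cvgD => //; apply: cvgMr; exact: partial_psum_cvg.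
apply/funext => N /=; rewrite sumEFin /= big_mkord.
rewrite (eq_bigr (fun i : 'I_N => \sum_(z <- binomial_coefs m) z.1 * s i ^+ z.2.+1)).
  2: by move=> i _; rewrite binomial_coefsE.
by rewrite exchange_big /=; apply: eq_bigr => z _; rewrite mulr_sumr.
Unshelve. all: by end_near. Qed.

Lemma binomial_psum_ge0 s m : mass_one s -> 0 <= psum_combination (binomial_coefs m) s.
Proof.
move=> sm; rewrite -lee_fin -binomial_psum//; apply: nneseries_ge0 => i _ _.
by rewrite lee_fin mulr_ge0 ?exprn_ge0 ?subr_ge0 ?mass_one_le1//; case: sm.
Qed.

(** The norm makes this a nonnegative function on the whole sequence space. *)
Definition entropy_series s : \bar R :=
  (\sum_(0 <= m <oo)
     (`|m.+1%:R^-1 * psum_combination (binomial_coefs m.+1) s|)%:E)%E.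

(** - x ln x is the sum over m of x (1 - x) ^ m.+1 / m.+1, and the two sums of
    nonnegative terms commute. *)
Lemma entropyE s : Sdown s -> entropy s = entropy_series s.
Proof.
move=> /Sdown_mass_one sm; have [s0 _] := sm.
have s01 i : 0 <= s i <= 1 by rewrite s0 mass_one_le1.
rewrite /entropy; under eq_eseriesr do rewrite entropy_termE//.
rewrite nneseries_interchange; last first.
  move=> i m; rewrite lee_fin mulr_ge0 ?invr_ge0// mulr_ge0 ?exprn_ge0 ?subr_ge0//.
  by case/andP: (s01 i).
apply: eq_eseriesr => m _.
under eq_eseriesr do rewrite EFinM.
rewrite nneseriesZl; last first.
  by move=> i _; rewrite lee_fin mulr_ge0 ?exprn_ge0 ?subr_ge0//; case/andP: (s01 i).
by rewrite binomial_psum// -EFinM ger0_norm// mulr_ge0 ?invr_ge0// binomial_psum_ge0.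
Qed.

(** The first power sum is one. *)
Lemma giniE kappa s : Sdown s -> gini kappa s =
  (`|psum_combination [:: (1, 0); (-1, kappa)] s|)%:E.
Proof.
move=> /Sdown_mass_one sm; have [s0 s1] := sm.
rewrite /gini psum_fin// /psum_combination !big_cons big_nil /= addr0 mulN1r mul1r.
rewrite psum1// ger0_norm// subr_ge0 -lee_fin -psum_fin// -s1.
apply: lee_nneseries => [i _ _|i _]; first by rewrite lee_fin exprn_ge0.
by rewrite lee_fin exprS ler_piMr// exprn_ile1// mass_one_le1.
Qed.

Lemma measurable_psum_combination l :
  measurable_fun setT (fun s : seqspace R => psum_combination l s).
Proof.
apply: measurable_sum => x; apply: measurable_funM => //; exact: measurable_psum.
Qed.

Lemma measurable_entropy_series :
  measurable_fun setT (fun s : seqspace R => entropy_series s).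
Proof.
apply: ge0_emeasurable_sum => [m s _ _|m _]; first by rewrite lee_fin.
apply/measurable_EFinP; apply: measurableT_comp => //.
by apply: measurable_funM => //; exact: measurable_psum_combination.
Qed.

End EntropyExpansion.

Section PosteriorValues.
Context d (Omega : measurableType d) (R : realType) (Pr : probability Omega R).
Variables (alpha theta : R) (P : probability (seqspace R) R).
Variable S : {RV Pr >-> seqspace R}.
Hypotheses (alpha_ge0 : 0 <= alpha) (alpha_lt1 : alpha < 1).
Hypothesis theta_gt : - alpha < theta.
Hypothesis P_PDP : is_PDP alpha theta P.
Hypothesis S_Sdown : forall w, Sdown (S w).
Hypothesis S_law : forall A, measurable A -> distribution Pr S A = P A.
Variables (n : nat) (p : seq nat).
Hypotheses (n_gt0 : (0 < n)%N) (p_abundance : abundance_vectors n p).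

Let p1 : all (leq 1) p. Proof. by case/andP: p_abundance. Qed.
Let pn : sumn p = n. Proof. by case/andP: p_abundance => _ /eqP. Qed.
Let p_nil : p != [::]. Proof. by apply: contraTneq n_gt0 => p0; rewrite -pn p0. Qed.
Let S_mass w : mass_one (S w). Proof. exact: Sdown_mass_one. Qed.
Let F := eppf alpha theta.

Let thn_gt0 : 0 < theta + n%:R. Proof. exact: (thetan_gt0 alpha_lt1). Qed.

(** The posterior mean of the power sum of exponent m: one more block of size m
    is either a new species or part of a species discovered before. *)
Definition posterior_psum m : R :=
  ((theta + (size p)%:R * alpha) * rising (1 - alpha) m.-1 +
   \sum_(a <- p) rising (a%:R - alpha) m) / rising (theta + n%:R) m.

Let sum_fall : \sum_(a <- p) (a%:R - alpha) = n%:R - (size p)%:R * alpha :> R.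
Proof.
by rewrite sumrB big_const_seq count_predT iter_addr_0 -natr_sum -sumnE pn mulr_natl.
Qed.

Lemma posterior_psum1 : posterior_psum 1 = 1.
Proof.
rewrite /posterior_psum rising0 mulr1 rising1.
under eq_bigr do rewrite rising1.
by rewrite sum_fall addrACA addrN addr0 divff// gt_eqF.
Qed.

Lemma expected_psum_dsum m : (0 < m)%N ->
  (\int[Pr]_w (psum (S w) m * dsum (S w) p)%:E = (F p * posterior_psum m)%:E)%E.
Proof.
move=> m0.
have mI q : measurable_fun setT (fun w => (`|dsum (S w) q|)%:E).
  apply/measurable_EFinP; apply: measurableT_comp => //.
  exact: measurable_dsum_comp.
have I q : all (leq 1) q -> (\int[Pr]_w (`|dsum (S w) q|)%:E = (F q)%:E)%E.
  move=> q1; rewrite -(expected_dsum alpha_ge0 alpha_lt1 theta_gt P_PDP S_Sdown)//.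
  by apply: eq_integral => w _; rewrite ger0_norm// dsum_ge0.
transitivity (\int[Pr]_w ((`|dsum (S w) (m :: p)|)%:E +
    \sum_(q <- bumps m p) (`|dsum (S w) q|)%:E))%E.
  apply: eq_integral => w _; rewrite sumEFin -EFinD; congr (_%:E).
  rewrite (ger0_norm (x := dsum _ (m :: p))); last by rewrite dsum_ge0//= m0.
  rewrite (_ : psum _ _ * _ = dsum (S w) (m :: p) +
    \sum_(q <- bumps m p) dsum (S w) q); last exact: distinct_sum_split.
  congr (_ + _).
  by apply: eq_big_seq => r rq; rewrite ger0_norm// dsum_ge0// (all_bumps p1 rq).
rewrite ge0_integralD//; last 2 first.
- by move=> w _; apply: sume_ge0.
- exact: emeasurable_sum.
rewrite ge0_integral_sum// I /= ?m0// (eq_big_seq (fun q => (F q)%:E)); last first.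
  by move=> q qb; rewrite I// (all_bumps p1 qb).
rewrite sumEFin -EFinD /F eppf_cons// sum_eppf_bumps// -mulrDr pn.
by rewrite -mulr_suml -mulrDl.
Qed.

Let iI m : (0 < m)%N ->
  Pr.-integrable setT (fun w => (psum (S w) m * dsum (S w) p)%:E).
Proof.
move=> m0; have mI : measurable_fun setT (fun w => (psum (S w) m * dsum (S w) p)%:E).
  apply/measurable_EFinP; apply: measurable_funM; last exact: measurable_dsum_comp.
  by apply: (@measurableT_comp _ _ _ _ _ _ (fun s : seqspace R => psum s m) _ S) => //;
    exact: measurable_psum.
apply/integrableP; split => //.
rewrite (eq_integral (fun w => (psum (S w) m * dsum (S w) p)%:E)).
  by rewrite expected_psum_dsum// ltry.
move=> w _; rewrite gee0_abs// lee_fin mulr_ge0 ?dsum_ge0//.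
rewrite -lee_fin -psum_fin//; apply: nneseries_ge0 => i _ _.
by rewrite lee_fin exprn_ge0//; case: (S_mass w).
Qed.

Lemma expected_combination (l : seq (R * nat)) :
  (\int[Pr]_w (psum_combination l (S w) * dsum (S w) p)%:E =
   (F p * \sum_(x <- l) x.1 * posterior_psum x.2.+1)%:E)%E.
Proof.
transitivity (\int[Pr]_w (\sum_(x <- l)
    (x.1%:E * (psum (S w) x.2.+1 * dsum (S w) p)%:E)))%E.
  apply: eq_integral => w _; rewrite /psum_combination mulr_suml -sumEFin.
  by apply: eq_bigr => x _; rewrite -EFinM mulrA.
rewrite integral_sum//; last by move=> x; apply: integrableZl => //; exact: iI.
rewrite mulr_sumr -sumEFin; apply: eq_bigr => x _.
by rewrite integralZl//; [rewrite expected_psum_dsum// -EFinM mulrCA|exact: iI].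
Qed.

Lemma gini_integral kappa :
  (\int[Pr]_w ((`|psum_combination [:: (1, 0); (-1, kappa)] (S w)|)%:E *
     (dsum (S w) p)%:E) = (F p * (1 - posterior_psum kappa.+1))%:E)%E.
Proof.
rewrite (eq_integral (fun w => (psum_combination [:: (1, 0%N); (-1, kappa)] (S w) *
  dsum (S w) p)%:E)).
  rewrite expected_combination !big_cons big_nil /= addr0 mul1r mulN1r.
  by rewrite posterior_psum1.
move=> w _; rewrite -EFinM; congr ((_ * _)%:E).
have := giniE kappa (S_Sdown w); rewrite /gini psum_fin// -EFinB => -[<-].
by rewrite /psum_combination !big_cons big_nil /= addr0 mul1r mulN1r psum1.
Qed.

(** The sum over the terms of s_i (1 - s_i)^m has the posterior mean given by
    the beta laws of the discovered and undiscovered frequencies. *)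
Lemma posterior_binomial m :
  \sum_(x <- binomial_coefs R m) x.1 * posterior_psum x.2.+1 =
  (theta + (size p)%:R * alpha) / (theta + n%:R) *
    (rising (theta + n%:R + alpha) m / rising (theta + n%:R + 1) m) +
  \sum_(a <- p) (a%:R - alpha) / (theta + n%:R) *
    (rising (theta + n%:R + alpha - a%:R) m / rising (theta + n%:R + 1) m).
Proof.
have c0 : 0 < theta + n%:R + 1 by rewrite addr_gt0.
rewrite big_map -[iota 0 m.+1]/(index_iota 0 m.+1) big_mkord /=.
transitivity (\sum_(r < m.+1) ((theta + (size p)%:R * alpha) / (theta + n%:R) *
    ((-1) ^+ r * 'C(m, r)%:R * (rising (1 - alpha) r / rising (theta + n%:R + 1) r)) +
  \sum_(a <- p) (a%:R - alpha) / (theta + n%:R) * ((-1) ^+ r * 'C(m, r)%:R *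
    (rising (a%:R - alpha + 1) r / rising (theta + n%:R + 1) r)))).
  apply: eq_bigr => r _; rewrite /posterior_psum /= risingSl.
  under [X in (_ + X) / _]eq_bigr do rewrite risingSl.
  rewrite mulrDl mulr_suml mulrDr mulr_sumr invfM; congr (_ + _); first by ring.
  by apply: eq_bigr => a _; ring.
rewrite big_split exchange_big /= -mulr_sumr chu_vandermonde//.
congr (_ * (rising _ _ / _) + _); first by ring.
apply: eq_bigr => a _; rewrite -mulr_sumr chu_vandermonde//.
by congr (_ * (rising _ _ / _)); ring.
Qed.

Definition harmonic_shift (a : nat) : R := \sum_(i < a) (1 - alpha + i%:R)^-1.

(* The sum of the two parameters is theta + n + 1 for every a: each step of the
   induction moves one unit from the second parameter to the first. *)
Let log_moment_discovered a : (a <= n)%N ->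
  log_moment (a%:R - alpha + 1) (theta + n%:R + alpha - a%:R) =
  log_moment (1 - alpha) (theta + n%:R + alpha) - harmonic_shift a.
Proof.
elim: a => [_|a ih an]; first by rewrite /harmonic_shift big_ord0 !subr0 addrC add0r.
have b0 : 0 < theta + n%:R + alpha - a.+1%:R.
  have -> : theta + n%:R + alpha - a.+1%:R = (theta + alpha) + (n - a.+1)%:R.
    by rewrite natrB//; ring.
  by rewrite ltr_wpDr// -ltrBlDr sub0r.
have a0 : 0 < a%:R - alpha + 1.
  by rewrite -addrA ltr_wpDl// addrC subr_gt0.
have := log_moment_shift a0 b0.
have -> : theta + n%:R + alpha - a.+1%:R + 1 = theta + n%:R + alpha - a%:R.
  by rewrite -natr1; ring.
rewrite ih 1?ltnW// => E.
rewrite /harmonic_shift big_ord_recr /= opprD addrA -/(harmonic_shift a) E.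
have -> : a.+1%:R - alpha + 1 = a%:R - alpha + 1 + 1 :> R by rewrite -natr1; ring.
have -> : 1 - alpha + a%:R = a%:R - alpha + 1 by ring.
by rewrite addrK.
Qed.

(** The posterior mean of the entropy; the first term depends on n only. *)
Definition posterior_entropy : R := log_moment (1 - alpha) (theta + n%:R + alpha) -
  (\sum_(a <- p) (a%:R - alpha) * harmonic_shift a) / (theta + n%:R).

(** Integrating the expansion of the entropy term by term. *)
Lemma entropy_integral :
  (\int[Pr]_w (entropy_series (S w) * (dsum (S w) p)%:E) =
   (F p * posterior_entropy)%:E)%E.
Proof.
have F0 : 0 < F p by exact: eppf_gt0.
have comb0 m w : 0 <= m.+1%:R^-1 * psum_combination (binomial_coefs R m.+1) (S w).
  by rewrite mulr_ge0 ?invr_ge0// binomial_psum_ge0.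
have mcomb m : measurable_fun setT (fun w => (m.+1%:R^-1 *
    psum_combination (binomial_coefs R m.+1) (S w) * dsum (S w) p)%:E).
  apply/measurable_EFinP; apply: measurable_funM; last exact: measurable_dsum_comp.
  apply: measurable_funM => //.
  by apply: (@measurableT_comp _ _ _ _ _ _
    (fun s : seqspace R => psum_combination (binomial_coefs R m.+1) s) _ S) => //;
    exact: measurable_psum_combination.
have c1 : 0 < 1 - alpha by rewrite subr_gt0.
have a_le a : a \in p -> (a <= n)%N.
  by move=> ap; rewrite -pn sumnE (big_rem a)//= leq_addr.
(* The posterior probabilities that the next individual is of a new species,
   and of a species with a individuals. *)
pose k0 : R := (theta + (size p)%:R * alpha) / (theta + n%:R).
pose k (a : nat) : R := (a%:R - alpha) / (theta + n%:R).
have k00 : 0 <= k0.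
  rewrite divr_ge0 ?(ltW thn_gt0)//; case: (p) p_nil => // b s _ /=.
  exact/ltW/weight_gt0.
have a_fall a : a \in p -> 0 < a%:R - alpha.
  move=> ap; rewrite subr_gt0 (lt_le_trans alpha_lt1)// ler1n.
  exact: (allP p1).
have k_ge0 a : a \in p -> 0 <= k a.
  by move=> ap; rewrite divr_ge0 ?(ltW thn_gt0)// ltW// a_fall.
have b_gt0 a : (a <= n)%N -> 0 < theta + n%:R + alpha - a%:R.
  move=> an.
  have -> : theta + n%:R + alpha - a%:R = (theta + alpha) + (n - a)%:R.
    by rewrite natrB//; ring.
  by rewrite ltr_wpDr// -ltrBlDr sub0r.
pose t0 m : R := log_moment_term (1 - alpha) (theta + n%:R + alpha) m.
pose t a m : R := log_moment_term (a%:R - alpha + 1) (theta + n%:R + alpha - a%:R) m.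
transitivity (\sum_(0 <= m <oo) ((F p)%:E * ((k0 * t0 m)%:E +
    (\sum_(a <- p) (`|k a * t a m|)%:E)%E)))%E.
  transitivity (\int[Pr]_w \sum_(0 <= m <oo) (m.+1%:R^-1 *
      psum_combination (binomial_coefs R m.+1) (S w) * dsum (S w) p)%:E)%E.
    apply: eq_integral => w _; rewrite muleC -nneseriesZl//.
    by apply: eq_eseriesr => m _; rewrite -EFinM ger0_norm// mulrC.
  rewrite integral_nneseries//; last first.
    by move=> m w _; rewrite lee_fin mulr_ge0// dsum_ge0.
  apply: eq_eseriesr => m _.
  transitivity (\int[Pr]_w ((m.+1%:R^-1)%:E *
      (psum_combination (binomial_coefs R m.+1) (S w) * dsum (S w) p)%:E))%E.
    by apply: eq_integral => w _; rewrite -EFinM mulrA.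
  rewrite ge0_integralZl//; last 2 first.
  - apply/measurable_EFinP; apply: measurable_funM; last exact: measurable_dsum_comp.
    by apply: (@measurableT_comp _ _ _ _ _ _
      (fun s : seqspace R => psum_combination (binomial_coefs R m.+1) s) _ S) => //;
      exact: measurable_psum_combination.
  - by move=> w _; rewrite lee_fin mulr_ge0 ?dsum_ge0// binomial_psum_ge0.
  rewrite expected_combination posterior_binomial -EFinM mulrCA EFinM; congr (_ * _)%E.
  rewrite sumEFin -EFinD; congr (_%:E); rewrite mulrDr; congr (_ + _).
    by rewrite /k0 /t0 /log_moment_term mulrCA (_ : 1 - alpha + _ = theta + n%:R + 1); ring.
  rewrite mulr_sumr; apply: eq_big_seq => a ap; rewrite ger0_norm; last first.
    rewrite mulr_ge0 ?k_ge0// log_moment_term_ge0// ?b_gt0 ?a_le//.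
    by rewrite addr_gt0// a_fall.
  rewrite /k /t /log_moment_term mulrCA.
  by rewrite (_ : a%:R - alpha + 1 + _ = theta + n%:R + 1); ring.
have t00 m : 0 <= t0 m.
  by apply: log_moment_term_ge0 => //; have := b_gt0 0%N (leq0n n); rewrite subr0.
have t_ge0 a m : a \in p -> 0 <= t a m.
  by move=> ap; apply: log_moment_term_ge0; [rewrite addr_gt0 ?a_fall|rewrite b_gt0 ?a_le].
rewrite nneseriesZl; last first.
  by move=> m _; rewrite adde_ge0 ?sume_ge0// lee_fin mulr_ge0.
rewrite [RHS]EFinM; congr (_ * _)%E.
rewrite nneseriesD; last 2 first.
- by move=> m _ _; rewrite lee_fin mulr_ge0.
- by move=> m _ _; rewrite sume_ge0.
rewrite nneseries_sum//.
have E0 : (\sum_(0 <= m <oo) (k0 * t0 m)%:E =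
    (k0 * log_moment (1 - alpha) (theta + n%:R + alpha))%:E)%E.
  under eq_eseriesr do rewrite EFinM.
  rewrite nneseriesZl; last by move=> m _; rewrite lee_fin.
  by rewrite log_momentE//; have := b_gt0 0%N (leq0n n); rewrite subr0.
have Ea a : a \in p -> (\sum_(0 <= m <oo) (`|k a * t a m|)%:E = (k a *
    (log_moment (1 - alpha) (theta + n%:R + alpha) - harmonic_shift a))%:E)%E.
  move=> ap; rewrite -log_moment_discovered ?a_le//.
  transitivity (\sum_(0 <= m <oo) ((k a)%:E * (t a m)%:E))%E.
    by apply: eq_eseriesr => m _; rewrite ger0_norm ?EFinM// mulr_ge0 ?k_ge0 ?t_ge0.
  rewrite nneseriesZl; last by move=> m _; rewrite lee_fin t_ge0.
  by rewrite log_momentE ?b_gt0 ?a_le// addr_gt0 ?a_fall.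
rewrite E0 (eq_big_seq _ Ea) sumEFin -EFinD; congr (_%:E).
under eq_bigr do rewrite mulrBr.
rewrite sumrB -mulr_suml addrA -mulrDl.
have -> : k0 + \sum_(a <- p) k a = 1.
  rewrite /k0 /k -mulr_suml -mulrDl sum_fall addrACA addrN addr0 divff// gt_eqF//.
rewrite mul1r /posterior_entropy; congr (_ - _).
by rewrite mulr_suml; apply: eq_bigr => a _; rewrite /k mulrAC.
Qed.

End PosteriorValues.

(** * Increments of the scores *)

Section AbundanceScores.
Variable R : realType.
Variable g : nat -> R.
Hypothesis g_superadditive : forall a, (0 < a)%N -> g 1%N + g a < g a.+1.
Variable L : nat -> seq nat -> \bar R.
Hypothesis LE : forall n p, (0 < n)%N -> abundance_vectors n p ->
  L n p = (\sum_(a <- p) g a - n%:R * g 1%N)%:E.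

Lemma sum_incr_nth (f : nat -> R) (p : seq nat) i : (i < size p)%N ->
  \sum_(a <- incr_nth p i) f a =
  \sum_(a <- p) f a + (f (nth 0%N p i).+1 - f (nth 0%N p i)).
Proof.
elim: p i => // a p ih [|i] /= ip; rewrite !big_cons; first by ring.
by rewrite ih//; ring.
Qed.

Lemma all_incr_nth p i : all (leq 1) p -> (i < size p)%N -> all (leq 1) (incr_nth p i).
Proof.
by elim: p i => // a p ih [|i] /= /andP[a1 p1] ip; rewrite ?p1 ?a1//= ih.
Qed.

Lemma sumn_incr_nth p i : (i < size p)%N -> sumn (incr_nth p i) = (sumn p).+1.
Proof. by elim: p i => // a p ih [|i] /= ip; rewrite ?addSn// ih// addnS. Qed.

Lemma successors_abundance n p q : (2 <= n)%N -> abundance_vectors n.-1 p ->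
  successors p q -> abundance_vectors n q.
Proof.
case: n => // n _ /= /andP[p1 /eqP pn] [->|[i ip ->]]; apply/andP.
  by rewrite all_rcons p1 sumn_rcons pn addn1.
by rewrite all_incr_nth// sumn_incr_nth// pn.
Qed.

(** A new species adds g 1 and the normalization subtracts it again; an
    individual added to a species with a members replaces g a by g a.+1, which
    exceeds g a + g 1. *)
Lemma score_increment n p q : (2 <= n)%N -> abundance_vectors n.-1 p ->
  successors p q ->
  (0 <= L n q - L n.-1 p)%E /\ ((L n q - L n.-1 p = 0)%E <-> q = rcons p 1%N).
Proof.
move=> n2 pn pq; have qn := successors_abundance n2 pn pq.
have n0 : (0 < n.-1)%N by case: n n2 {pn qn} => [|[]].
have n1 : (0 < n)%N by apply: leq_trans n2.
have -> : (L n q - L n.-1 p = (\sum_(a <- q) g a - \sum_(a <- p) g a - g 1%N)%:E)%E.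
  rewrite !LE// -EFinB; congr (_%:E); rewrite -[in n%:R](prednK n1) -natr1; ring.
case: pq => [->|[i ip qE]].
  have -> : \sum_(a <- rcons p 1%N) g a - \sum_(a <- p) g a - g 1%N = 0.
    by rewrite -cats1 big_cat big_seq1 /=; ring.
  by rewrite lexx.
have qp : q <> rcons p 1%N.
  by move=> /(congr1 size); rewrite qE size_incr_nth ip size_rcons; lia.
have d0 : 0 < \sum_(a <- q) g a - \sum_(a <- p) g a - g 1%N.
  have a0 : (0 < nth 0%N p i)%N.
    by case/andP: pn => /all_nthP h _; exact: h.
  by rewrite qE sum_incr_nth//; have := g_superadditive a0; lra.
split; first by rewrite lee_fin ltW.
by split => // -[] /eqP; rewrite gt_eqF.
Qed.

End AbundanceScores.

Section Scores.
Variables (R : realType) (alpha : R).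
Hypotheses (alpha_ge0 : 0 <= alpha) (alpha_lt1 : alpha < 1).

Definition entropy_score a : R := (a%:R - alpha) * harmonic_shift alpha a.

(** The second summand is the contribution of the new-species weight, spread
    over the species. *)
Definition gini_score kappa a : R :=
  rising (a%:R - alpha) kappa.+1 + alpha * rising (1 - alpha) kappa.

(** The increment of the score is 1 plus a harmonic sum, which is the growth of
    the digamma function between 1 - alpha and a + 1 - alpha. *)
Lemma entropy_score_superadditive a : (0 < a)%N ->
  entropy_score 1 + entropy_score a < entropy_score a.+1.
Proof.
move=> a0; have c0 : 0 < 1 - alpha by rewrite subr_gt0.
have i0 k : 0 < 1 - alpha + k%:R by rewrite ltr_wpDr.
rewrite /entropy_score /harmonic_shift big_ord1 addr0 divff ?gt_eqF//.
rewrite big_ord_recr /= mulrDr.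
have -> : a.+1%:R - alpha = 1 - alpha + a%:R by rewrite -natr1; ring.
rewrite divff ?gt_eqF// addrC ltrD2r ltr_pM2r.
  by lra.
case: a a0 => // a _; rewrite big_ord_recl ltr_wpDr ?invr_gt0//.
by apply: sumr_ge0 => j _; rewrite invr_ge0 ltW.
Qed.

(** By the difference equation of the rising factorials, the increment minus
    [gini_score kappa 1] is kappa.+1 times the difference of the rising
    factorials of order kappa at a + 1 - alpha and at 1 - alpha. *)
Lemma gini_score_superadditive kappa a : (0 < kappa)%N -> (0 < a)%N ->
  gini_score kappa 1 + gini_score kappa a < gini_score kappa a.+1.
Proof.
move=> k0 a0; have c0 : 0 < 1 - alpha by rewrite subr_gt0.
have := rising_addn (a%:R - alpha) kappa.+1.
rewrite /gini_score (_ : a.+1%:R - alpha = a%:R - alpha + 1); last by rewrite -natr1; ring.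
have lt : rising (1 - alpha) kappa < rising (a%:R - alpha + 1) kappa.
  have a1 : 0 < a%:R :> R by rewrite ltr0n.
  by apply: ltr_rising => //; lra.
have : rising (1 - alpha) kappa.+1 = rising (1 - alpha) kappa * (1 - alpha + kappa%:R).
  exact: risingSr.
have : 0 <= kappa%:R :> R by [].
rewrite /= -natr1; nra.
Qed.

End Scores.

Theorem proposition4 (R : realType) (alpha theta : R) (kappa : nat)
    (P : probability (seqspace R) R)
    (d : measure_display) (Omega : measurableType d)
    (Pr : probability Omega R)
    (S : {RV Pr >-> seqspace R}) (X : nat -> {RV Pr >-> R})
    (left : nat -> seqspace R -> R)
    (alpha_ge0 : 0 <= alpha) (alpha_lt1 : alpha < 1)
    (theta_gt : - alpha < theta) (kappa_gt0 : (0 < kappa)%N)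
    (P_PDP : is_PDP alpha theta P)
    (S_Sdown : forall w, Sdown (S w))
    (S_law : forall A, measurable A -> distribution Pr S A = P A)
    (X_iid : iid_uniform X)
    (SX_indep : independent_of_sample S X)
    (left_intervals : interval_system left)
    (n : nat) (n_ge2 : (2 <= n)%N) (p q : seq nat)
    (p_abundance : abundance_vectors n.-1 p)
    (q_successor : successors p q) :
  ((0 <= L_entropy S X left theta n q - L_entropy S X left theta n.-1 p)%E /\
   ((L_entropy S X left theta n q - L_entropy S X left theta n.-1 p = 0)%E
      <-> q = rcons p 1%N)) /\
  ((0 <= L_gini S X left theta kappa n q
         - L_gini S X left theta kappa n.-1 p)%E /\
   ((L_gini S X left theta kappa n q
         - L_gini S X left theta kappa n.-1 p = 0)%E
      <-> q = rcons p 1%N)).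
Proof.
have ones m : abundance_vectors m (nseq m 1%N).
  by apply/andP; split; [rewrite all_nseq orbT|rewrite sumn_nseq mul1n eqxx].
have th_gt0 m : (0 < m)%N -> 0 < theta + m%:R by apply: (thetan_gt0 alpha_lt1 theta_gt).
have sum_ones (f : nat -> R) m : \sum_(a <- nseq m 1%N) f a = m%:R * f 1%N.
  by rewrite big_nseq iter_addr_0 mulr_natl.
split.
- apply: (score_increment (g := entropy_score alpha)) => // [a a0|m r m0 rm].
    exact: entropy_score_superadditive.
  have post t : abundance_vectors m t ->
      posterior_mean S X left (@entropy R) m t = (posterior_entropy alpha theta m t)%:E.
    move=> tm; apply: (posterior_meanE alpha_ge0 alpha_lt1 theta_gt P_PDP S_Sdown S_law
      X_iid SX_indep left_intervals tm (@measurable_entropy_series R)).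
    + by move=> s; apply: nneseries_ge0.
    + by move=> s; exact: entropyE.
    + exact: (entropy_integral alpha_ge0 alpha_lt1 theta_gt P_PDP S_Sdown S_law m0 tm).
  rewrite /L_entropy !post// -EFinB -EFinM; congr (_%:E).
  rewrite /posterior_entropy sum_ones /entropy_score.
  by field; rewrite gt_eqF// th_gt0.
- apply: (score_increment (g := gini_score alpha kappa)) => // [a a0|m r m0 rm].
    exact: gini_score_superadditive.
  have post t : abundance_vectors m t ->
      posterior_mean S X left (gini kappa) m t =
      (1 - posterior_psum alpha theta m t kappa.+1)%:E.
    move=> tm; apply: (posterior_meanE alpha_ge0 alpha_lt1 theta_gt P_PDP S_Sdown S_law
      X_iid SX_indep left_intervals tm
      (G := fun s => (`|psum_combination [:: (1, 0%N); (-1, kappa)] s|)%:E)).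
    + apply/measurable_EFinP; apply: measurableT_comp => //.
      exact: measurable_psum_combination.
    + by move=> s; rewrite lee_fin.
    + by move=> s; exact: giniE.
    + exact: (gini_integral alpha_ge0 alpha_lt1 theta_gt P_PDP S_Sdown S_law m0 tm).
  rewrite /L_gini !post// -EFinB -EFinM; congr (_%:E).
  rewrite big_mkord -/(rising (theta + m%:R) kappa.+1).
  have r0 : rising (theta + m%:R) kappa.+1 != 0 by rewrite gt_eqF// rising_gt0// th_gt0.
  rewrite /posterior_psum sum_ones size_nseq /gini_score big_split /=.
  rewrite big_const_seq count_predT iter_addr_0.
  by field.
Qed.
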